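(* Let $G$ be a connected claw-free graph and let $k$ be a non-negative integer. If $\sigma^{5}_{2}(G)\geqslant |G|-3k-6$, then $G$ has a spanning tree $T$ such that $\mathrm{Stem}(T)$ has at most $k$ branch vertices.
   Context: All graphs are finite and simple (no loops, no multiple edges). $|G|$ denotes the number of vertices of $G$, $\deg_G(v)$ the degree of $v$ in $G$, and $d_G(u,v)$ the distance between $u$ and $v$ in $G$. A graph is claw-free if it has no induced subgraph isomorphic to $K_{1,3}$. For an integer $l\geqslant 2$, $\alpha^{l}(G)=\max\{|S| : S\subset V(G),\ d_G(x,y)\geqslant l \text{ for all distinct } x,y\in S\}$. For integers $l\geqslant 2$ and $m\geqslant 2$, $$\sigma^{l}_{m}(G)=\min\Big\{\sum_{a\in S}\deg_G(a) : S\subset V(G),\ |S|=m,\ d_G(x,y)\geqslant l \text{ for all distinct } x,y\in S\Big\},$$ with the convention $\sigma^{l}_{m}(G)=+\infty$ if $\alpha^{l}(G)<m$. For a tree $T$, a leaf is a vertex of degree one in $T$, and $\mathrm{Leaf}(T)$ is the set of leaves of $T$. A branch vertex of a tree is a vertex of degree at least three in that tree. The stem of $T$ is the subtree $\mathrm{Stem}(T)=T-\mathrm{Leaf}(T)$ obtained by deleting all leaves of $T$; the branch vertices of $\mathrm{Stem}(T)$ are the vertices whose degree in $\mathrm{Stem}(T)$ is at least three. *)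

(* Defs.v *)
From mathcomp Require Import all_boot all_order all_algebra.
From mathcomp Require Import constructive_ereal.

Set Implicit Arguments.
Unset Strict Implicit.
Unset Printing Implicit Defensive.

Import Order.TTheory GRing.Theory Num.Theory.

Record sgraph (V : finType) := SGraph {
  edge : rel V;
  edge_sym : symmetric edge;
  edge_irrefl : irreflexive edge }.

Definition deg (V : finType) (G : sgraph V) (v : V) : nat :=
  #|[set u | edge G v u]|.

(* The null graph is not connected. *)
Definition connected_graph (V : finType) (G : sgraph V) : Prop :=
  0 < #|V| /\ forall x y, connect (edge G) x y.

Section Induced.
Variables (V : finType) (G : sgraph V) (A : {set V}).

Definition induced_edge : rel {x | x \in A} :=
  fun x y => edge G (val x) (val y).

Lemma induced_edge_sym : symmetric induced_edge.
Proof. by move=> x y; apply: edge_sym. Qed.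

Lemma induced_edge_irrefl : irreflexive induced_edge.
Proof. by move=> x; apply: edge_irrefl. Qed.

Definition induced : sgraph {x | x \in A} :=
  SGraph induced_edge_sym induced_edge_irrefl.

End Induced.

Definition isomorphic (V W : finType) (G : sgraph V) (H : sgraph W) : Prop :=
  exists2 f : V -> W, bijective f & {mono f : x y / edge G x y >-> edge H x y}.

Section CompleteBipartite.
Variables m n : nat.

Definition Kbip_edge : rel ('I_m + 'I_n)%type := fun x y =>
  match x, y with inl _, inr _ | inr _, inl _ => true | _, _ => false end.

Lemma Kbip_edge_sym : symmetric Kbip_edge.
Proof. by case=> [?|?] [?|?]. Qed.

Lemma Kbip_edge_irrefl : irreflexive Kbip_edge.
Proof. by case. Qed.

Definition Kbip : sgraph ('I_m + 'I_n)%type :=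
  SGraph Kbip_edge_sym Kbip_edge_irrefl.

End CompleteBipartite.

Definition claw_free (V : finType) (G : sgraph V) : Prop :=
  forall A : {set V}, ~ isomorphic (induced G A) (Kbip 1 3).

(* Distances and degree sums take values in \bar int so that +oo is available
   and the lower bound on a degree sum may be negative.  A shortest walk
   repeats no vertex, so it is enough to consider walks with fewer than #|V|
   edges; the distance between different components is +oo. *)
Definition dist (V : finType) (G : sgraph V) (x y : V) : \bar int :=
  \big[Order.min/+oo%E]_(n < #|V| |
      [exists p : n.-tuple V, path (edge G) x p && (last x p == y)])
    (n%:Z)%:E.

Definition scattered (l : nat) (V : finType) (G : sgraph V) (S : {set V})
    : bool :=
  [forall x in S, forall y in S, (x != y) ==> ((l%:Z)%:E <= dist G x y)%E].

Definition alpha (l : nat) (V : finType) (G : sgraph V) : nat :=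
  \max_(S : {set V} | scattered l G S) #|S|.

Definition sigma (l m : nat) (V : finType) (G : sgraph V) : \bar int :=
  if alpha l G < m then +oo%E else
  \big[Order.min/+oo%E]_(S : {set V} | (#|S| == m) && scattered l G S)
    ((\sum_(a in S) deg G a)%N%:Z)%:E.

Definition acyclic (V : finType) (G : sgraph V) : Prop :=
  forall p : seq V, 3 <= size p -> ~ ucycle (edge G) p.

Definition is_tree (V : finType) (G : sgraph V) : Prop :=
  connected_graph G /\ acyclic G.

Definition spanning_tree (V : finType) (G T : sgraph V) : Prop :=
  is_tree T /\ subrel (edge T) (edge G).

Definition leaves (V : finType) (T : sgraph V) : {set V} :=
  [set v | deg T v == 1].

Definition stem (V : finType) (T : sgraph V) : sgraph {x | x \in ~: leaves T} :=
  induced T (~: leaves T).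

Definition branch_vertices (V : finType) (G : sgraph V) : {set V} :=
  [set v | 3 <= deg G v].

(* Main.v *)
Require Import Defs.
From mathcomp Require Import all_boot all_order all_algebra.
From mathcomp Require Import constructive_ereal.
From mathcomp Require Import zify.
From Stdlib Require Import Classical_Prop.

Set Implicit Arguments.
Unset Strict Implicit.
Unset Printing Implicit Defensive.

(** A spanning tree whose stem lies inside a given subgraph [H] is obtained from
    any connected dominating subgraph [H] of [G]: hang every vertex missed by
    [H] on a neighbour in [H] and take a spanning tree of the result.  The hung
    vertices are leaves, so every branch vertex of the stem has degree at least
    three in [H] ([stem_branches_le_excess]).  Hence it is enough to find a
    connected dominating [H] of excess at most [k], where the excess of [H] is
    the sum over all vertices of the degree minus two, truncated at zero.

    Working with connected subgraphs and their excess, rather than with trees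
    and branch vertices, makes surgery cheap: after a change only connectivity
    has to be checked.  A subgraph of minimum positive excess is automatically
    a tree, because a cycle edge could be slid along vertices of degree two to
    a branch vertex and deleted there ([optimal_bridges]); so it has at least
    excess + 2 leaves ([excess_le_leafs]).  Joining two leaves would close a
    cycle without raising the excess, so leaves are pairwise non-adjacent in
    [G], and remain so after each leaf is prolonged through vertices outside
    [H] ([optimal_leafs_nonadj], [optimal_extend], [tips_far]).

    Among the subgraphs of minimum excess choose one with a leaf [l] as close as
    possible to a branch vertex, then with as few private neighbours of [l] as
    possible (vertices outside [H] whose only neighbour in [H] is [l]), then
    with as few vertices as possible.  Every leaf then has a private neighbour,
    since otherwise it could be pruned.  Let [x] be private to [l] and [y]
    private to another leaf [m].  Then [x] and [y] are at distance at least five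
    ([best_privates_far]).  Indeed, by the non-adjacency of prolonged leaves, a
    shorter walk must pass through a vertex [s] of [H], not a leaf, adjacent to
    a tip [a] reached from [l] and a tip [c] reached from [m], with [a] and [c]
    non-adjacent.  Apply claw-freeness at [s].  If [s] is a branch vertex, a tip
    can be attached to a neighbour of [s] in place of [s], which lowers the
    excess ([optimal_tips_no_branch]).  If [s] has degree two and lies on the
    path from [l] to its branch vertex, attaching [c] to [s] gives a leaf closer
    to that branch vertex ([leg_no_chord]).  Otherwise let [z1] and [z2] be the
    neighbours of [s].  When [a] is adjacent to some [zi], it can be inserted in
    the edge [zi s]: if [a] is outside [H] the vertex [x] stops being private to
    [l] ([best_no_insertion]), and if [a] is [l] itself its old neighbour
    becomes a leaf closer to the branch vertex ([leg_no_relocation]).  When [z1]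
    and [z2] are adjacent, [s] can be bypassed and then used to join [a] to [c]
    ([optimal_no_bypass]).

    Finally count.  Let [L] be the number of leaves.  Claw-freeness gives
    different leaves different, non-leaf neighbours, so [H] has at least [2 L]
    vertices.  The neighbourhoods of [x] and [y], the vertices of [H] other than
    [l] and [m], and one private neighbour for each leaf are disjoint, so the
    degrees of [x] and [y] add up to at most [n - 3 L + 2], where [n] is the
    order of [G].  The hypothesis bounds this sum below by [n - 3 k - 6], which
    leaves [3 L <= 3 k + 8], hence [L <= k + 2] and the excess is at most
    [k]. *)

(** * Relations as edge sets: degrees, adding and deleting edges, cuts *)

(** [lia] on the natural-number facts of the context only: the many boolean
    hypotheses about adjacency would otherwise all be case-split. *)
Ltac nat_lia :=
  intros;
  repeat match goal with
  | h : ?T |- _ =>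
    lazymatch T with
    | is_true (leq _ _) => fail
    | @eq nat _ _ => fail
    | not (@eq nat _ _) => fail
    | _ => clear h
    end
  end; lia.

Section Relations.
Variable V : finType.
Implicit Types (e H : rel V) (u v w x y z : V).

Lemma connect_image e e' (f : V -> V) x y :
    (forall u v, e u v -> connect e' (f u) (f v)) ->
  connect e x y -> connect e' (f x) (f y).
Proof.
move=> ee' /connectP[p]; elim: p x => [|z p IHp] x /=; first by move=> _ ->.
by case/andP=> /ee' xz /IHp zy /zy; apply: connect_trans.
Qed.

(** The hypothesis is only required of edges reachable from [x], which is what
    allows [e'] to lack edges on the far side of a cut. *)
Lemma connect_from e e' x y :
    (forall u v, connect e x u -> e u v -> e' u v) ->
  connect e x y -> connect e' x y.
Proof.
move=> ee' /connectP[p]; elim: p x ee' => [|z p IHp] x ee' /=.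
  by move=> _ ->.
case/andP=> xz ezp def_y; apply: connect_trans (connect1 _) _.
  exact: ee' xz.
apply: IHp ezp def_y => u v zu; apply: ee'.
exact: connect_trans (connect1 xz) zu.
Qed.

Lemma connect_closed_under e (a : pred V) x y :
    (forall u v, e u v -> a u -> a v) -> connect e x y -> a x -> a y.
Proof.
move=> ea /connectP[p]; elim: p x => [|z p IHp] x /=; first by move=> _ ->.
by case/andP=> /ea xz /IHp zy /zy az /xz.
Qed.

Definition dg H v := #|[set w | H v w]|.

Definition add_edge u v H : rel V :=
  fun x y => [|| H x y, (x == u) && (y == v) | (x == v) && (y == u)].

Definition del_edge u v H : rel V :=
  fun x y => H x y && ~~ ((x == u) && (y == v) || (x == v) && (y == u)).

Lemma dg_gt0P H v : reflect (exists w, H v w) (0 < dg H v).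
Proof.
by apply: (iffP card_gt0P) => -[w]; exists w; rewrite ?inE // in p *; rewrite inE.
Qed.

Lemma dg_gt0 H v w : H v w -> 0 < dg H v.
Proof. by move=> vw; apply/dg_gt0P; exists w. Qed.

Lemma dg0_edgeF H v w : dg H v = 0 -> H v w = false.
Proof. by move=> v0; apply: contra_eqF v0 => /dg_gt0; rewrite lt0n. Qed.

Lemma dg1_eq H v w w' : dg H v = 1 -> H v w -> H v w' -> w' = w.
Proof.
move=> /eqP/cards1P[z def_z] vw vw'.
have: w \in [set z] by rewrite -def_z inE.
have: w' \in [set z] by rewrite -def_z inE.
by rewrite !inE => /eqP-> /eqP->.
Qed.

Lemma dg2_eq H v w w' x :
  dg H v <= 2 -> H v w -> H v w' -> w != w' -> H v x -> (x == w) || (x == w').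
Proof.
move=> v2 vw vw' ww' vx; apply/norP => -[xw xw'].
suff: 3 <= dg H v by nat_lia.
have <-: #|[set x; w; w']| = 3.
  by rewrite setUC cardsU1 cards2 !inE (eq_sym w') (negbTE xw') xw /= eq_sym ww'.
by apply/subset_leq_card/subsetP=> z; rewrite !inE => /orP[/orP[]|] /eqP->.
Qed.

Lemma dg2P H v : dg H v = 2 -> exists w w', [/\ H v w, H v w' & w != w'].
Proof.
move=> /eqP/cards2P[w [w' [ww' def_v]]]; exists w, w'; split=> //.
  by have: w \in [set w; w']; [rewrite !inE eqxx | rewrite -def_v inE].
by have: w' \in [set w; w']; [rewrite !inE eqxx orbT | rewrite -def_v inE].
Qed.

Lemma dg_third H v w w' :
  3 <= dg H v -> exists z, [/\ H v z, z != w & z != w'].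
Proof.
move=> v3; have: 0 < #|[set x | H v x] :\ w :\ w'|.
  have := cardsD1 w [set x | H v x]; rewrite -/(dg H v).
  have := cardsD1 w' ([set x | H v x] :\ w).
  by nat_lia.
by case/card_gt0P=> z; rewrite !inE => /and3P[zw' zw vz]; exists z.
Qed.

Lemma add_edge_sym u v H : symmetric H -> symmetric (add_edge u v H).
Proof.
move=> Hsym x y; rewrite /add_edge Hsym orbC [RHS]orbC.
by rewrite orbC [(x == u) && _]andbC [(x == v) && _]andbC orbC; congr orb;
   rewrite orbC.
Qed.

Lemma del_edge_sym u v H : symmetric H -> symmetric (del_edge u v H).
Proof.
move=> Hsym x y; rewrite /del_edge Hsym orbC.
by rewrite [(x == u) && _]andbC [(x == v) && _]andbC.
Qed.

Lemma del_edgeC u v H : del_edge u v H =2 del_edge v u H.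
Proof. by move=> x y; rewrite /del_edge orbC. Qed.

Lemma add_edge_sub u v H : subrel H (add_edge u v H).
Proof. by move=> x y xy; rewrite /add_edge xy. Qed.

Lemma del_edge_sub u v H : subrel (del_edge u v H) H.
Proof. by move=> x y /andP[]. Qed.

Lemma add_edge_new u v H : add_edge u v H u v.
Proof. by rewrite /add_edge !eqxx orbT. Qed.

Lemma del_edge_away u v H x y : x != u -> y != u -> H x y -> del_edge u v H x y.
Proof. by move=> xu yu xy; rewrite /del_edge xy (negbTE xu) (negbTE yu) andbF. Qed.

Lemma add_edge_off u v H x y : x != u -> x != v -> add_edge u v H x y = H x y.
Proof. by move=> xu xv; rewrite /add_edge (negbTE xu) (negbTE xv) /= orbF. Qed.

Lemma del_edge_off u v H x y : x != u -> x != v -> del_edge u v H x y = H x y.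
Proof. by move=> xu xv; rewrite /del_edge (negbTE xu) (negbTE xv) /= andbT. Qed.

Lemma dg_add_edge u v H x : symmetric H -> u != v -> ~~ H u v ->
  dg (add_edge u v H) x = dg H x + (x == u) + (x == v).
Proof.
move=> Hsym uv nHuv; rewrite /dg; have [xu|xu] := eqVneq x u.
  rewrite xu (negbTE uv) addn0.
  have ->: [set w | add_edge u v H u w] = v |: [set w | H u w].
    by apply/setP=> w; rewrite !inE /add_edge eqxx (negbTE uv) /= orbF orbC.
  by rewrite cardsU1 inE nHuv addnC.
have [xv|xv] := eqVneq x v.
  rewrite xv addn0.
  have ->: [set w | add_edge u v H v w] = u |: [set w | H v w].
    apply/setP=> w; rewrite !inE /add_edge eqxx eq_sym (negbTE uv) /=.
    by rewrite orbC.
  by rewrite cardsU1 inE Hsym nHuv addnC.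
by rewrite !addn0; apply: eq_card => w; rewrite !inE add_edge_off.
Qed.

Lemma dg_del_edge u v H x : symmetric H -> u != v -> H u v ->
  dg (del_edge u v H) x + (x == u) + (x == v) = dg H x.
Proof.
move=> Hsym uv Huv.
have nduv: ~~ del_edge u v H u v by rewrite /del_edge !eqxx andbF.
rewrite -(dg_add_edge _ (del_edge_sym u v Hsym) uv nduv).
apply: eq_card => w; rewrite !inE /add_edge /del_edge.
set c := (X in ~~ X); have: c -> H x w.
  by case/orP=> /andP[/eqP-> /eqP->]; rewrite // Hsym.
rewrite -/c; case: (c) => cH; last by rewrite andbT orbF.
by rewrite cH ?orbT.
Qed.

Lemma connect_neq_dg e x y : connect e x y -> x != y -> 0 < dg e x.
Proof.
case/connectP=> -[|z p] /=; first by move=> _ ->; rewrite eqxx.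
by case/andP=> /dg_gt0.
Qed.

Lemma cut_sides H u v r :
  connect H u r -> connect (del_edge u v H) u r \/ connect (del_edge u v H) v r.
Proof.
move=> ur; apply/orP; pose e := del_edge u v H.
apply: (connect_closed_under (a := fun r => connect e u r || connect e v r)) ur _.
  move=> x y xy; case: (boolP (e x y)) => [/connect1 exy|].
    by case/orP=> /connect_trans/(_ exy)->; rewrite ?orbT.
  rewrite /e /del_edge xy negbK => /orP[] /andP[_ /eqP->] _;
  by rewrite connect0 ?orbT.
by rewrite connect0.
Qed.

(** In a tree, [w] is then the neighbour of [v] on the path from [v] to [r]. *)
Definition toward H r v w := H v w && connect (del_edge v w H) w r.

(** The first edge of a path without repetition from [v] to [r] works, because
    the rest of the path avoids [v]. *)
Lemma toward_exists H r v :
  connect H v r -> v != r -> exists w, toward H r v w.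
Proof.
case/connectP=> p vp def_r; case/shortenP: vp def_r => -[|w q] /=.
  by move=> _ _ _ ->; rewrite eqxx.
case/andP=> vw wq /andP[vNq _] _ def_r _; exists w; rewrite /toward vw /=.
apply/connectP; exists q => //.
apply: (sub_in_path (P := predC1 v)) wq.
  by move=> x y xv yv; apply: del_edge_away.
by apply/allP=> z zq /=; apply: contraNneq vNq => <-.
Qed.

Definition all_bridges H := forall u v, H u v -> ~~ connect (del_edge u v H) u v.

(** In a forest the route from [v] to [r] is unique: the component of [w] behind
    the bridge [vw] does not contain [v], so it survives the deletion of any
    other edge at [v]. *)
Lemma toward_unique H r v w w' : symmetric H -> all_bridges H ->
  toward H r v w -> toward H r v w' -> w = w'.
Proof.
move=> Hsym Hbr /andP[vw wr] /andP[vw' w'r]; apply: contraNeq (Hbr _ _ vw') => ww'.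
have dsym x y := sym_connect_sym (del_edge_sym x y Hsym).
have wr': connect (del_edge v w' H) w r.
  apply: connect_from wr => x y wx /[dup] xy /del_edge_sub Hxy.
  have vF z: connect (del_edge v w H) w z -> z != v.
    move=> wz; apply: contraTneq wz => ->; rewrite dsym; exact: Hbr.
  apply: del_edge_away Hxy; apply: vF => //.
  exact: connect_trans wx (connect1 xy).
apply: connect_trans (connect_trans (connect1 _) wr') _; last by rewrite dsym.
rewrite /del_edge vw eqxx (negbTE ww') /=.
by apply: contraNN ww' => /andP[/eqP<- /eqP->].
Qed.

End Relations.

(** * Connected dominating subgraphs of minimum excess *)

Section Subgraphs.
Variables (V : finType) (G : sgraph V).
Implicit Types (H : rel V) (u v w x y z : V).

(** The vertices of the subgraph are those of positive degree, so that an edge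
    relation alone describes it. *)
Record connected_sub H : Prop := ConnectedSub {
  csub_sym : symmetric H;
  csub_edge : subrel H (edge G);
  csub_connect : forall x y, 0 < dg H x -> 0 < dg H y -> connect H x y }.

Definition dominating H :=
  forall x, dg H x = 0 -> exists2 y, edge G x y & 0 < dg H y.

Definition excess H := \sum_v (dg H v - 2).

Lemma csub_neq H u v : connected_sub H -> H u v -> u != v.
Proof.
by case=> _ HG _ /HG; apply: contraTneq => ->; rewrite edge_irrefl.
Qed.

Lemma csub_dgr H u v : connected_sub H -> H u v -> 0 < dg H v.
Proof. by case=> Hsym _ _; rewrite Hsym => /dg_gt0. Qed.

Lemma edge_neq u v : edge G u v -> u != v.
Proof. by apply: contraTneq => ->; rewrite edge_irrefl. Qed.

Lemma connected_sub_add H u v :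
  connected_sub H -> edge G u v -> 0 < dg H u -> connected_sub (add_edge u v H).
Proof.
case=> Hsym HG Hconn uv u0; split.
- exact: add_edge_sym.
- move=> x y /or3P[/HG//||] /andP[/eqP-> /eqP->] //; by rewrite edge_sym.
have sym := sym_connect_sym (add_edge_sym u v Hsym).
have to_u x : 0 < dg (add_edge u v H) x -> connect (add_edge u v H) x u.
  case/dg_gt0P=> y; have [->|xu] := eqVneq x u; first by rewrite connect0.
  have [-> _|xv] := eqVneq x v; first by rewrite sym connect1 ?add_edge_new.
  rewrite add_edge_off // => /dg_gt0 x0.
  apply: (connect_sub _ (Hconn _ _ x0 u0)) => a b ab.
  exact/connect1/add_edge_sub.
by move=> x y /to_u xu /to_u yu; apply: connect_trans xu _; rewrite sym.
Qed.

Lemma connected_sub_del H u v : connected_sub H ->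
  connect (del_edge u v H) u v -> connected_sub (del_edge u v H).
Proof.
case=> Hsym HG Hconn uv; split.
- exact: del_edge_sym.
- by move=> x y /del_edge_sub/HG.
have sym := sym_connect_sym (del_edge_sym u v Hsym).
have sub x: 0 < dg (del_edge u v H) x -> 0 < dg H x.
  by case/dg_gt0P=> y /del_edge_sub/dg_gt0.
move=> x y /sub x0 /sub y0; apply: (connect_sub _ (Hconn _ _ x0 y0)) => a b ab.
case: (boolP (del_edge u v H a b)) => [/connect1//|].
by rewrite /del_edge ab negbK => /orP[] /andP[/eqP-> /eqP->] //; rewrite sym.
Qed.

(** Every walk survives the contraction of the leaf [l] onto its neighbour. *)
Lemma connected_sub_prune H l p : connected_sub H ->
  dg H l = 1 -> H l p -> connected_sub (del_edge l p H).
Proof.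
move=> Hc l1 lp; case: (Hc) => Hsym HG Hconn; split.
- exact: del_edge_sym.
- by move=> x y /del_edge_sub/HG.
have lN z : H l z -> z = p by apply: dg1_eq.
pose f x := if x == l then p else x.
have fE x : 0 < dg (del_edge l p H) x -> f x = x.
  rewrite /f; case: eqP => // ->; have := dg_del_edge l Hsym (csub_neq Hc lp) lp.
  by rewrite eqxx; nat_lia.
have sub x: 0 < dg (del_edge l p H) x -> 0 < dg H x.
  by case/dg_gt0P=> y /del_edge_sub/dg_gt0.
move=> x y x0 y0; rewrite -(fE x) // -(fE y) //.
apply: connect_image (Hconn _ _ (sub _ x0) (sub _ y0)) => a b.
rewrite /f; case: (eqVneq a l) => [->|al].
  by move/[dup]/lN->; rewrite ?connect0 // eq_sym (negbTE (csub_neq Hc lp)).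
case: (eqVneq b l) => [->|bl ab]; first by rewrite Hsym => /lN->.
by apply/connect1/del_edge_away.
Qed.

Lemma leq_excess H H' :
  (forall x, dg H' x - 2 <= dg H x - 2) -> excess H' <= excess H.
Proof. by move=> le; apply: leq_sum => x _. Qed.

Lemma ltn_excess H H' x0 : (forall x, dg H' x - 2 <= dg H x - 2) ->
  dg H' x0 - 2 < dg H x0 - 2 -> excess H' < excess H.
Proof.
move=> le lt; rewrite /excess (bigD1 x0) // [X in _ < X](bigD1 x0) //=.
by rewrite -addSn leq_add // leq_sum.
Qed.

Lemma excess_gt0P H : reflect (exists b, 3 <= dg H b) (0 < excess H).
Proof.
rewrite lt0n sum_nat_eq0 negb_forall.
by apply: (iffP existsP) => -[b]; exists b; move: p => /=; lia.
Qed.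

Definition leafs H := [set v | dg H v == 1].

(** Fix a root [r].  Each edge leads to [r] from exactly one of its ends, and each
    vertex other than [r] has exactly one edge leading to [r]; so the degrees add
    up to at most twice the number of vertices minus two, and comparing with
    [2] vertex by vertex gives the bound. *)
Lemma excess_le_leafs H : connected_sub H -> all_bridges H -> 0 < excess H ->
  excess H + 2 <= #|leafs H|.
Proof.
move=> Hc Hbr /excess_gt0P[r r3]; have [Hsym _ Hconn] := Hc.
pose t v w := toward H r v w.
have t_le1 v : \sum_w t v w <= (0 < dg H v) && (v != r).
  have [->|vr] := eqVneq v r.
    rewrite andbF big1 // => w _; apply/eqP; rewrite eqb0; apply/negP=> /andP[rw].
    rewrite (sym_connect_sym (del_edge_sym _ _ Hsym)); apply/negP; exact: Hbr.
  case: (boolP [exists w, t v w]) => [/existsP[w tw]|/existsPn nt]; last first.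
    by rewrite big1 // => w _; apply/eqP; rewrite eqb0.
  have -> /= : 0 < dg H v by case/andP: tw => /dg_gt0.
  rewrite (bigD1 w) //= big1 ?addn0 ?leq_b1 // => w' ww'.
  apply/eqP; rewrite eqb0; apply: contraNN ww' => /toward_unique-/(_ w).
  by move/(_ Hsym Hbr tw)->.
have arcs v w : H v w <= t v w + t w v.
  case: (boolP (H v w)) => //= vw; rewrite addn_gt0 !lt0b /t /toward vw Hsym vw /=.
  rewrite (eq_connect (del_edgeC w v H)).
  have: connect H v r by apply: Hconn; rewrite ?(dg_gt0 vw) //; nat_lia.
  by case/(cut_sides w)=> ->; rewrite ?orbT.
have dgE v : dg H v = \sum_w H v w.
  by rewrite /dg -sum1dep_card big_mkcond; apply: eq_bigr => w _; case: (H v w).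
pose A := [set v | 0 < dg H v].
have sum_dg : \sum_v dg H v <= 2 * #|A :\ r|.
  have le : \sum_v dg H v <= \sum_v \sum_w t v w + \sum_v \sum_w t w v.
    rewrite -big_split; apply: leq_sum => v _; rewrite dgE -big_split.
    by apply: leq_sum => w _; apply: arcs.
  have tA : \sum_v \sum_w t v w <= #|A :\ r|.
    rewrite -sum1_card [X in _ <= X]big_mkcond; apply: leq_sum => v _.
    by apply: leq_trans (t_le1 v) _; rewrite !inE andbC; case: ifP.
  by move: le tA; rewrite [X in _ <= _ + X]exchange_big /=; nat_lia.
have sumE : \sum_v dg H v + #|leafs H| = 2 * #|A| + excess H.
  rewrite -!sum1_card !(big_mkcond (fun v => v \in _)) /= big_distrr -!big_split /=.
  by apply: eq_bigr => v _; rewrite !inE; case: ifP; case: ifP; lia.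
have := cardsD1 r A; have -> : r \in A by rewrite inE; nat_lia.
by move: sum_dg sumE; nat_lia.
Qed.

(** Positivity of the excess is part of the notion: a cycle has excess zero and
    is not a tree, whereas every optimal subgraph is one. *)
Record optimal H : Prop := Optimal {
  opt_csub : connected_sub H;
  opt_dom : dominating H;
  opt_pos : 0 < excess H;
  opt_min : forall H', connected_sub H' -> dominating H' -> excess H <= excess H' }.

Lemma dominating_sub H H' : dominating H ->
  (forall x, 0 < dg H x -> 0 < dg H' x) -> dominating H'.
Proof.
move=> dom sub x x0; have [|y xy y0] := dom x; last by exists y; rewrite ?sub.
by apply/eqP; rewrite eqn0Ngt; apply: contra_eqN x0 => /sub; rewrite lt0n.
Qed.

Lemma optimal_same H H' : optimal H -> connected_sub H' -> dominating H' ->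
  (forall x, dg H' x - 2 <= dg H x - 2) -> optimal H'.
Proof.
move=> [Hc Hd Hp Hm] H'c H'd /leq_excess le; split=> //.
  exact: leq_trans (Hm _ H'c H'd).
by move=> K Kc Kd; apply: leq_trans le (Hm _ Kc Kd).
Qed.

Lemma optimal_no_less H H' x0 : optimal H -> connected_sub H' -> dominating H' ->
  (forall x, dg H' x - 2 <= dg H x - 2) -> dg H' x0 - 2 < dg H x0 - 2 -> False.
Proof.
move=> [_ _ _ Hm] H'c H'd le lt.
by have := ltn_excess le lt; rewrite ltnNge Hm.
Qed.

Lemma dg_del_connect H u v x : symmetric H -> connect (del_edge u v H) u v ->
  u != v -> 0 < dg H x -> 0 < dg (del_edge u v H) x.
Proof.
move=> Hsym uv nuv; case: (eqVneq x u) => [-> _|xu].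
  exact: connect_neq_dg uv nuv.
case: (eqVneq x v) => [-> _|xv].
  apply: (@connect_neq_dg _ _ v u); last by rewrite eq_sym.
  by rewrite (sym_connect_sym (del_edge_sym _ _ Hsym)).
by case/dg_gt0P=> y xy; apply/dg_gt0P; exists y; rewrite del_edge_off.
Qed.

(** An edge that is not a bridge cannot meet a branch vertex, where deleting it
    would lower the excess.  At a vertex of degree two both edges lie on the same
    cycles, so being an end of a non-bridge spreads to the whole subgraph, which
    would then have no branch vertex at all. *)
Lemma optimal_bridges H : optimal H -> all_bridges H.
Proof.
move=> Hopt u v uv; apply/negP=> uv'; have [Hc Hd Hp _] := Hopt.
have [Hsym _ Hconn] := Hc.
(* [B] holds at the ends of non-bridges; it is closed under adjacency in [H]. *)
pose B x := [exists w, H x w && connect (del_edge x w H) x w].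
have no_branch x w : H x w -> connect (del_edge x w H) x w -> dg H x <= 2.
  move=> xw xw'; rewrite leqNgt; apply/negP=> x3; have nxw := csub_neq Hc xw.
  have dgd z := dg_del_edge z Hsym nxw xw.
  apply: (@optimal_no_less H (del_edge x w H) x Hopt).
  - exact: connected_sub_del.
  - by apply: dominating_sub Hd _ => z; apply: dg_del_connect.
  - by move=> z; have := dgd z; nat_lia.
  - by have := dgd x; rewrite eqxx; nat_lia.
have Bclosed x y : H x y -> B x -> B y.
  move=> xy /existsP[w /andP[xw cxw]]; apply/existsP; exists x.
  rewrite Hsym xy (eq_connect (del_edgeC y x H)).
  have sym a b := sym_connect_sym (del_edge_sym a b Hsym).
  rewrite sym; have [->|yw] := eqVneq y w; first by rewrite cxw.
  have x2 := no_branch _ _ xw cxw; have xw_neq := csub_neq Hc xw.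
  have [h /andP[/andP[xh hP] hw]] := toward_exists cxw xw_neq.
  have {x2}hy : h = y.
    have := dg2_eq x2 xy xw yw xh; case/orP=> /eqP // hw'.
    by move: hP; rewrite hw' !eqxx.
  rewrite {h}hy in xh hP hw; rewrite sym.
  have yw': connect (del_edge x y H) y w.
    apply: connect_sub hw => a b /andP[/del_edge_sub ab ne]; apply: connect1.
    by rewrite /del_edge ab.
  apply: connect_trans yw' (connect1 _); rewrite /del_edge Hsym xw /= eqxx andbT.
  by rewrite eq_sym (negbTE xw_neq) /= eq_sym.
have Bu: B u by apply/existsP; exists v; rewrite uv.
case/excess_gt0P: Hp => b b3.
have: B b by apply: (connect_closed_under Bclosed) Bu; apply: Hconn; rewrite ?(dg_gt0 uv) //; nat_lia.
by case/existsP=> w /andP[bw /(no_branch _ _ bw)]; nat_lia.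
Qed.

Lemma optimal_connect H x y : optimal H -> 0 < dg H x -> 0 < dg H y -> connect H x y.
Proof. by move=> /opt_csub/csub_connect; apply. Qed.

(** Adding the edge would keep the excess and close a cycle. *)
Lemma optimal_leafs_nonadj H u v : optimal H ->
  dg H u = 1 -> dg H v = 1 -> u != v -> ~~ edge G u v.
Proof.
move=> Hopt u1 v1 uv; apply/negP=> Guv; have [Hc Hd Hp _] := Hopt.
have [Hsym _ Hconn] := Hc.
have u0: 0 < dg H u by nat_lia. have v0: 0 < dg H v by nat_lia.
have nHuv : ~~ H u v.
  apply/negP=> Huv; case/excess_gt0P: Hp => b b3.
  have: connect H u b by apply: Hconn; nat_lia.
  move/(connect_closed_under (a := pred2 u v)) => /(_ _ _)/orP[]/=.
  - move=> x y xy /orP[] /eqP xE; rewrite {x}xE in xy.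
      by rewrite (dg1_eq u1 Huv xy) eqxx orbT.
    by rewrite Hsym in Huv; rewrite (dg1_eq v1 Huv xy) eqxx.
  - by rewrite eqxx.
  - by move/eqP=> bE; rewrite bE u1 in b3.
  - by move/eqP=> bE; rewrite bE v1 in b3.
have dga x := dg_add_edge x Hsym uv nHuv.
have: optimal (add_edge u v H).
  apply: optimal_same Hopt (connected_sub_add Hc Guv u0) _ _.
    by apply: dominating_sub Hd _ => x; rewrite dga; nat_lia.
  move=> x; rewrite dga; have [->|] := eqVneq x u; first by rewrite (negbTE uv); nat_lia.
  by have [->|] := eqVneq x v; nat_lia.
move/optimal_bridges/(_ u v (add_edge_new _ _ _))/negP; apply.
apply: connect_sub (Hconn _ _ u0 v0) => x y xy; apply: connect1.
rewrite /del_edge /add_edge xy /=; apply: contraNN nHuv.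
by case/orP=> /andP[/eqP<- /eqP<-]; rewrite // Hsym.
Qed.

(** Prolonging a leaf [l] by a vertex [x] outside [H] moves the leaf to [x] at no
    cost. *)
Lemma optimal_extend H l x : optimal H -> dg H l = 1 -> edge G l x ->
  dg H x = 0 ->
  optimal (add_edge l x H) /\
  forall y, dg (add_edge l x H) y = dg H y + (y == l) + (y == x).
Proof.
move=> Hopt l1 lx x0; have [Hc Hd _ _] := Hopt; have [Hsym _ _] := Hc.
have nlx := edge_neq lx.
have nHlx : ~~ H l x by rewrite Hsym dg0_edgeF.
have dga y := dg_add_edge y Hsym nlx nHlx; split=> //.
apply: optimal_same Hopt _ _ _.
- by apply: connected_sub_add; rewrite // l1.
- by apply: dominating_sub Hd _ => y; rewrite dga; nat_lia.
- move=> y; rewrite dga; have [->|] := eqVneq y l; first by rewrite (negbTE nlx); nat_lia.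
  by have [->|] := eqVneq y x; nat_lia.
Qed.

(** Replacing [zt] by [uz], for a leaf [u] on the side of [t], turns [u] into a
    vertex of degree two and takes one from the degree of [t]; hence [t] cannot be
    a branch vertex, and it becomes a leaf. *)
Lemma optimal_rotate H u z t : optimal H -> dg H u = 1 -> edge G u z ->
  H z t -> u != t -> connect (del_edge z t H) u t ->
  [/\ optimal (del_edge z t (add_edge u z H)),
      forall x, dg (del_edge z t (add_edge u z H)) x + (x == t) = dg H x + (x == u)
    & dg H t = 2].
Proof.
move=> Hopt u1 uz zt ut cut; have [Hc Hd _ _] := Hopt; have [Hsym _ _] := Hc.
have nzt := csub_neq Hc zt; have nuz := edge_neq uz.
have sym a b := sym_connect_sym (del_edge_sym a b Hsym).
have nHuz : ~~ H u z.
  apply: contraTN (optimal_bridges Hopt zt) => Huz; rewrite negbK.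
  apply: connect_trans (connect1 _) cut.
  rewrite /del_edge Hsym Huz eqxx (negbTE ut) /=.
  by rewrite (negbTE nzt).
set K := add_edge u z H; have Ksym : symmetric K by apply: add_edge_sym.
have dgK x := dg_add_edge x Hsym nuz nHuz; rewrite -/K in dgK.
have Kzt : K z t by apply: add_edge_sub.
have dgK' x := dg_del_edge x Ksym nzt Kzt.
have cK : connect (del_edge z t K) z t.
  apply: connect_trans (connect1 _) (connect_sub _ cut).
    by rewrite /del_edge Ksym [K u z]add_edge_new eqxx (negbTE ut) (negbTE nzt).
  by move=> a b /andP[ab ne]; apply: connect1; rewrite /del_edge /K add_edge_sub.
have u0 : 0 < dg H u by rewrite u1.
have Kc : connected_sub K by apply: connected_sub_add.
have K'c := connected_sub_del Kc cK.
have dgE x : dg (del_edge z t K) x + (x == t) = dg H x + (x == u).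
  by have := dgK x; have := dgK' x; nat_lia.
have K'd : dominating (del_edge z t K).
  apply: dominating_sub Hd _ => x x0; apply: dg_del_connect => //.
  by rewrite dgK; nat_lia.
have le x : dg (del_edge z t K) x - 2 <= dg H x - 2.
  have := dgE x; have [->|_] := eqVneq x u; last by nat_lia.
  by rewrite u1 (negbTE ut); nat_lia.
split=> //; first exact: optimal_same Hopt _ _ le.
have t_le : dg H t <= 2.
  rewrite leqNgt; apply/negP=> t3.
  apply: (@optimal_no_less H _ t Hopt K'c K'd le).
  by have := dgE t; rewrite eqxx eq_sym (negbTE ut); nat_lia.
have : 2 <= dg H t; last by nat_lia.
have: 0 < dg (del_edge z t H) t.
  by apply: (@connect_neq_dg _ _ t u); rewrite 1?eq_sym // sym.
by have := dg_del_edge t Hsym nzt zt; rewrite eqxx; nat_lia.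
Qed.

Lemma subdivide H z s q : connected_sub H -> H z s -> dg H q = 0 ->
  edge G z q -> edge G q s ->
  let K := del_edge z s (add_edge q s (add_edge z q H)) in
  connected_sub K /\ forall x, dg K x = dg H x + 2 * (x == q).
Proof.
move=> Hc zs q0 zq qs K; have [Hsym _ _] := Hc.
have nzs := csub_neq Hc zs; have nzq := edge_neq zq; have nqs := edge_neq qs.
have s0 := csub_dgr Hc zs.
have nHzq : ~~ H z q by rewrite Hsym dg0_edgeF.
set K1 := add_edge z q H in K *.
have K1sym : symmetric K1 by apply: add_edge_sym.
have dg1 x := dg_add_edge x Hsym nzq nHzq; rewrite -/K1 in dg1.
have nK1qs : ~~ K1 q s.
  rewrite K1sym /K1 add_edge_off; [| by rewrite eq_sym | by rewrite eq_sym].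
  by rewrite Hsym dg0_edgeF.
set K2 := add_edge q s K1 in K *.
have K2sym : symmetric K2 by apply: add_edge_sym.
have dg2 x := dg_add_edge x K1sym nqs nK1qs; rewrite -/K2 in dg2.
have K2zs : K2 z s by do 2!apply: add_edge_sub.
have dg3 x := dg_del_edge x K2sym nzs K2zs; rewrite -/K in dg3.
split; last first.
  by move=> x; have := dg1 x; have := dg2 x; have := dg3 x; nat_lia.
have K1c : connected_sub K1 by apply: connected_sub_add => //; apply: dg_gt0 zs.
have K2c : connected_sub K2.
  by apply: connected_sub_add => //; rewrite dg1 eqxx; nat_lia.
apply: connected_sub_del K2c _.
have K2zq : K2 z q by apply/add_edge_sub/add_edge_new.
have K2qs : K2 q s by apply: add_edge_new.
apply: (@connect_trans _ _ q); apply: connect1; rewrite /del_edge.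
  by rewrite K2zq eqxx (negbTE nqs) (negbTE nzs).
by rewrite K2qs (eq_sym q) (negbTE nzq) (negbTE nqs).
Qed.

End Subgraphs.

(** * Claws and least elements *)

Lemma ex_least (T : Type) (P : T -> Prop) (f : T -> nat) :
  (exists x, P x) -> exists2 x, P x & forall y, P y -> f x <= f y.
Proof.
case=> x; have [n] := ubnP (f x); elim: n x => // n IHn x fxn Px.
have [[y Py fyx]|no] := classic (exists2 y, P y & f y < f x).
  by apply: IHn Py; nat_lia.
exists x => // y Py; rewrite leqNgt; apply/negP=> fyx; apply: no.
by exists y.
Qed.

Lemma claw_freeP (V : finType) (G : sgraph V) s x y z : claw_free G ->
  edge G s x -> edge G s y -> edge G s z -> x != y -> x != z -> y != z ->
  [|| edge G x y, edge G x z | edge G y z].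
Proof.
move=> claw sx sy sz xy xz yz; apply: contraT; rewrite !negb_or.
case/and3P=> nxy nxz nyz; exfalso.
have neq u : edge G s u -> s != u.
  by apply: contraTneq => <-; rewrite edge_irrefl.
pose A := [set s; x; y; z].
have sA : s \in A by rewrite !inE eqxx.
have xA : x \in A by rewrite !inE eqxx ?orbT.
have yA : y \in A by rewrite !inE eqxx ?orbT.
have zA : z \in A by rewrite !inE eqxx ?orbT.
pose g (i : 'I_1 + 'I_3) : {u | u \in A} :=
  match i with
  | inl _ => exist _ s sA
  | inr i => if val i == 0 then exist _ x xA
             else if val i == 1 then exist _ y yA else exist _ z zA
  end.
pose f (u : {u | u \in A}) : 'I_1 + 'I_3 :=
  if val u == s then inl ord0 else
  inr (inord (if val u == x then 0 else if val u == y then 1 else 2)).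
have neqF (u w : V) : u != w -> (w == u) = false by move=> uw; rewrite eq_sym (negbTE uw).
have [[xs ys] zs] := (neqF _ _ (neq _ sx), neqF _ _ (neq _ sy), neqF _ _ (neq _ sz)).
have [[yx zx] zy] := (neqF _ _ xy, neqF _ _ xz, neqF _ _ yz).
have fK : cancel f g.
  move=> u; apply: val_inj; have := valP u; rewrite /f.
  by rewrite !inE -!orbA => /or4P[]/eqP->; rewrite ?eqxx ?xs ?ys ?zs ?yx ?zx ?zy /= ?inordK.
have gK : cancel g f.
  case=> [i|[[|[|[|//]]] i]]; rewrite /g /f /= ?eqxx ?xs ?ys ?zs ?yx ?zx ?zy ?ord1 //;
  by congr inr; apply: val_inj; rewrite /= inordK.
apply: (claw A); exists f; first by exists g.
suff gE i j : edge (induced G A) (g i) (g j) = edge (Kbip 1 3) i j.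
  by move=> u v; rewrite -[in LHS]gE !fK.
rewrite /= /induced_edge.
case: i => [i|[[|[|[|//]]] i]]; case: j => [j|[[|[|[|//]]] j]] //=;
  rewrite ?edge_irrefl ?(edge_sym G _ s) ?(edge_sym G z) ?(edge_sym G y x) ?sx ?sy ?sz ?(negbTE nxy)
    ?(negbTE nxz) ?(negbTE nyz) //.
Qed.

(** * Shortest legs and private neighbours *)

Section Legs.
Variables (V : finType) (G : sgraph V).
Implicit Types (H K : rel V) (l m s x y z : V) (p : seq V).

Lemma toward_antisym H r v w : symmetric H -> all_bridges H ->
  toward H r v w -> toward H r w v -> False.
Proof.
move=> Hsym Hbr /andP[vw wr] /andP[wv]; rewrite (eq_connect (del_edgeC w v H)).
move=> vr; have /negP := Hbr _ _ vw; apply; apply: connect_trans vr _.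
by rewrite (sym_connect_sym (del_edge_sym _ _ Hsym)).
Qed.

Definition privates H l :=
  [set x | [&& dg H x == 0, edge G l x &
            [forall w, edge G x w && (0 < dg H w) ==> (w == l)]]].

Lemma privatesP H l x : reflect
  [/\ dg H x = 0, edge G l x & forall w, edge G x w -> 0 < dg H w -> w = l]
  (x \in privates H l).
Proof.
rewrite inE; apply: (iffP and3P) => -[x0 lx only].
  split=> // [|w xw w0]; first exact/eqP.
  by apply/eqP; move/forallP/(_ w)/implyP: only; apply; rewrite xw.
split=> //; first exact/eqP.
by apply/forallP=> w; apply/implyP=> /andP[/only w_l /w_l ->].
Qed.

Definition legged H l p :=
  [/\ dg H l = 1, path H l p & 3 <= dg H (last l p)].

Record shortest_leg H l p : Prop := ShortestLeg {
  sleg_opt : optimal G H;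
  sleg_leg : legged H l p;
  sleg_min : forall H' l' p',
    optimal G H' -> legged H' l' p' -> size p <= size p' }.

(** A shortest leg is what [leg_no_chord] and [leg_no_relocation] rely on; the
    first tie-break serves [best_no_insertion], the second one
    [best_leaf_has_private]. *)
Record best H l p : Prop := Best {
  best_leg : shortest_leg H l p;
  best_privates : forall H' l', shortest_leg H' l' p ->
    #|privates H l| <= #|privates H' l'|;
  best_card : forall H' l', shortest_leg H' l' p ->
    #|privates H' l'| <= #|privates H l| ->
    #|[set x | 0 < dg H x]| <= #|[set x | 0 < dg H' x]| }.

Lemma shortest_leg_same H l p H' l' : shortest_leg H l p ->
  optimal G H' -> legged H' l' p -> shortest_leg H' l' p.
Proof. by case=> _ _ Hmin H'opt leg. Qed.

Lemma best_exists H : optimal G H -> exists K l p, best K l p.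
Proof.
move=> Hopt; have [Hc _ Hp _] := Hopt.
have [[[H1 l1] p] [/= o1 leg1] min1] :
    exists2 t, optimal G t.1.1 /\ legged t.1.1 t.1.2 t.2 &
      forall t', optimal G t'.1.1 /\ legged t'.1.1 t'.1.2 t'.2 ->
        size t.2 <= size t'.2.
  apply: (ex_least (P := fun t => optimal G t.1.1 /\ legged t.1.1 t.1.2 t.2)
                   (fun t => size t.2)).
  have /card_gt0P[l] : 0 < #|leafs H|.
    by have := excess_le_leafs Hc (optimal_bridges Hopt) Hp; nat_lia.
  rewrite inE => /eqP l1; case/excess_gt0P: Hp => b b3.
  have /connectP[p lp def_b] : connect H l b by apply: optimal_connect Hopt _ _; lia.
  by exists (H, l, p); split=> //=; split=> //; rewrite -def_b.
have s1 : shortest_leg H1 l1 p.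
  by split=> // H' l' p' o' leg'; apply: (min1 (H', l', p')).
have [[H2 l2] /= s2 min2] :
    exists2 t, shortest_leg t.1 t.2 p & forall t', shortest_leg t'.1 t'.2 p ->
      #|privates t.1 t.2| <= #|privates t'.1 t'.2|.
  apply: (ex_least (P := fun t => shortest_leg t.1 t.2 p)
                   (fun t => #|privates t.1 t.2|)).
  by exists (H1, l1).
have [[H3 l3] /= [s3 le3] min3] :
    exists2 t, shortest_leg t.1 t.2 p /\ #|privates t.1 t.2| <= #|privates H2 l2| &
      forall t', shortest_leg t'.1 t'.2 p /\
          #|privates t'.1 t'.2| <= #|privates H2 l2| ->
        #|[set x | 0 < dg t.1 x]| <= #|[set x | 0 < dg t'.1 x]|.
  apply: (ex_least (P := fun t => shortest_leg t.1 t.2 p /\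
                      #|privates t.1 t.2| <= #|privates H2 l2|)
                   (fun t => #|[set x | 0 < dg t.1 x]|)).
  by exists (H2, l2).
exists H3, l3, p; split=> // H' l' s'.
  exact: leq_trans le3 (min2 (H', l') s').
by move=> le'; apply: (min3 (H', l')); split=> //; apply: leq_trans le' le3.
Qed.

(** Removing loops would shorten the leg. *)
Lemma leg_uniq H l p : shortest_leg H l p -> uniq (l :: p).
Proof.
case=> Hopt [l1 lp b3] Hmin; case: (shortenP lp) b3 => q lq uq sub b3.
have [_ qp] : _ * _ := uniq_min_size (proj2 (andP uq)) sub (Hmin H l q Hopt (And3 l1 lq b3)).
rewrite /= -qp; case/andP: uq => -> uq.
exact: leq_size_uniq uq sub (Hmin H l q Hopt (And3 l1 lq b3)).
Qed.

(** An inner branch vertex could replace the end of the leg, and an inner leaf its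
    start. *)
Lemma leg_inner H l p1 x p2 : shortest_leg H l (p1 ++ x :: p2) ->
  p2 != [::] -> dg H x = 2.
Proof.
case=> Hopt [l1]; rewrite cat_path last_cat /= => /and3P[lp1 p1x xp2] b3 Hmin p2N.
have x_le : dg H x <= 2.
  rewrite leqNgt; apply/negP=> x3; have := Hmin H l (rcons p1 x) Hopt.
  rewrite size_cat size_rcons /=; case: p2 p2N {xp2 b3 Hmin} => //= y p2 _.
  suff: legged H l (rcons p1 x) by move=> leg /(_ leg); nat_lia.
  by split; rewrite ?rcons_path ?lp1 ?last_rcons.
have x_neq1 : dg H x <> 1.
  move=> x1; have := Hmin H x p2 Hopt (And3 x1 xp2 b3).
  by rewrite size_cat /=; nat_lia.
have := csub_dgr (opt_csub Hopt) p1x; nat_lia.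
Qed.

Lemma leg_dg H l p x : shortest_leg H l p -> x \in p -> 2 <= dg H x.
Proof.
move=> sleg xp; case/splitPr: xp sleg => p1 [|y p2] sleg; last first.
  by rewrite (leg_inner sleg).
by case: sleg => _ [_ _]; rewrite last_cat /=; nat_lia.
Qed.

(** From [l] on, the inner vertices of the leg have degree two, so the route from
    each of them to an outside vertex [c] cannot turn back and follows the leg. *)
Lemma leg_toward H l p c q s t r : shortest_leg H l p ->
  0 < dg H c -> c \notin l :: p -> l :: p = q ++ s :: t :: r -> toward H c s t.
Proof.
move=> sleg c0 cNp; have [Hopt [l1 lp _] _] := sleg.
have [Hc _ _ _] := Hopt; have [Hsym _ Hconn] := Hc.
have Hbr := optimal_bridges Hopt.
have exists_toward x : x \in l :: p -> exists w, toward H c x w.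
  move=> xp; apply: toward_exists; last by apply: contraNneq cNp => <-.
  apply: Hconn => //; move: xp; rewrite inE => /predU1P[->|]; first by rewrite l1.
  by move/(leg_dg sleg); nat_lia.
elim/last_ind: q s t r => [|q u IHq] s t r def_p.
  have [w] : exists w, toward H c s w.
    by apply: exists_toward; rewrite def_p inE eqxx.
  case: def_p lp => <- -> /= /andP[lt _] tw.
  by rewrite -(dg1_eq l1 lt (proj1 (andP tw))).
rewrite cat_rcons in def_p; have us := IHq _ _ _ def_p.
have [w] : exists w, toward H c s w.
  by apply: exists_toward; rewrite def_p mem_cat !inE eqxx !orbT.
have /= := leg_uniq sleg; rewrite -/(uniq (l :: p)) def_p.
rewrite cat_uniq /= !inE !negb_or => /and3P[_ _ /andP[/and3P[_ ut _] _]].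
have st : H s t.
  have : path H (head l (l :: p)) (behead (l :: p)) by [].
  rewrite def_p; case: (q) => [|v q'] /=; first by case/and3P.
  by rewrite cat_path /= => /and4P[_ _ _ /andP[]].
have su : H s u by rewrite Hsym; case/andP: us.
have s2 : dg H s = 2.
  case: (q) def_p => [|v q'] /= [_ pE]; rewrite pE in sleg.
    by apply: (@leg_inner H l [::] s (t :: r)).
  by apply: (@leg_inner H l (rcons q' u) s (t :: r)); rewrite ?cat_rcons.
move=> sw; have := dg2_eq _ su st ut (proj1 (andP sw)); rewrite s2.
case/(_ isT)/orP=> /eqP wE; rewrite wE // in sw *.
by case: (toward_antisym Hsym Hbr us sw).
Qed.

(** The leaf [c] lies beyond the end of the leg.  Attaching [c] to [s] and cutting
    the leg after [s] makes the next vertex [t] a leaf with a shorter leg. *)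
Lemma leg_no_chord H l p c s : shortest_leg H l p -> dg H c = 1 -> c != l ->
  s \in p -> dg H s = 2 -> edge G c s -> False.
Proof.
move=> sleg c1 cl sp s2 cs; have [Hopt [l1 lp b3] Hmin] := sleg.
have [Hc _ _ _] := Hopt; have [Hsym _ _] := Hc.
have cNp : c \notin l :: p.
  rewrite inE negb_or cl; apply/negP=> /(leg_dg sleg); nat_lia.
case/splitPr: sp => p1 [|t p2] in sleg lp b3 Hmin cNp *.
  by rewrite last_cat /= s2 in b3.
have /andP[st tc] : toward H c s t.
  by apply: (@leg_toward H l _ c (l :: p1) s t p2 sleg _ cNp); rewrite ?c1.
have ct : c != t.
  by apply: contraNneq cNp => ->; rewrite inE mem_cat !inE eqxx !orbT.
have tc' : connect (del_edge s t H) c t.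
  by rewrite (sym_connect_sym (del_edge_sym _ _ Hsym)).
have [Kopt dgK t2] := optimal_rotate Hopt c1 cs st ct tc'.
set K := del_edge s t _ in Kopt dgK.
have := leg_uniq sleg; rewrite cons_uniq cat_uniq => /and4P[_ _ _].
rewrite /= inE negb_or => /andP[/andP[st' sNp2] _].
suff leg : legged K t p2.
  have := Hmin K t p2 Kopt leg; rewrite size_cat /=; nat_lia.
move: lp b3; rewrite cat_path last_cat /= => /and4P[_ _ _ tp2] b3; split.
- by have := dgK t; rewrite eqxx eq_sym (negbTE ct) t2; nat_lia.
- apply: (sub_in_path (P := predC1 s)) tp2.
    by move=> x y xs ys xy; apply: del_edge_away => //; apply: add_edge_sub.
  by rewrite /= eq_sym st' /=; apply/allP=> x xp2 /=; apply: contraNneq sNp2 => <-.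
- have := dgK (last t p2); case: eqP => [E|_]; last by rewrite addn0 => ->; exact: leq_trans b3 (leq_addr _ _).
  by rewrite E t2 in b3.
Qed.

(** Only the private neighbours of a leaf depend on it for domination, and pruning
    it next to a branch vertex would lower the excess. *)
Lemma optimal_prune H m v : optimal G H -> dg H m = 1 -> H m v ->
  privates H m = set0 ->
  [/\ optimal G (del_edge m v H),
      forall x, dg (del_edge m v H) x + (x == m) + (x == v) = dg H x
    & dg H v = 2].
Proof.
move=> Hopt m1 mv no_priv; have [Hc Hd _ _] := Hopt; have [Hsym HG _] := Hc.
have nmv := csub_neq Hc mv; have dgK x := dg_del_edge x Hsym nmv mv.
have v2 : 2 <= dg H v.
  have v0 := csub_dgr Hc mv; have v1 : dg H v <> 1; last by nat_lia.
  by move=> v1; have /negP := optimal_leafs_nonadj Hopt m1 v1 nmv; apply; apply: HG.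
set K := del_edge m v H in dgK *.
have Kc : connected_sub G K by apply: connected_sub_prune.
have K_gt0 x : 0 < dg H x -> x != m -> 0 < dg K x.
  move=> x0 xm; have := dgK x; rewrite (negbTE xm).
  by have [->|_] := eqVneq x v; nat_lia.
have Kd : dominating G K.
  move=> x x0; have [->|xm] := eqVneq x m.
    by exists v; [exact: HG | apply: K_gt0; rewrite 1?eq_sym //; nat_lia].
  have Hx0 : dg H x = 0.
    by apply/eqP; rewrite eqn0Ngt; apply/negP=> /K_gt0/(_ xm); rewrite x0.
  have [/existsP[w /and3P[xw w0 wm]]|/existsPn only] :=
    boolP [exists w, [&& edge G x w, 0 < dg H w & w != m]].
    by exists w => //; apply: K_gt0.
  have only' w : edge G x w -> 0 < dg H w -> w = m.
    by move=> xw w0; apply/eqP; have := only w; rewrite xw w0 negbK.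
  have [y xy y0] := Hd x Hx0; have ym := only' y xy y0.
  suff: x \in privates H m by rewrite no_priv inE.
  by apply/privatesP; split; rewrite // edge_sym -ym.
have le x : dg K x - 2 <= dg H x - 2 by have := dgK x; nat_lia.
split=> //; first exact: optimal_same Hopt _ _ le.
suff: dg H v <= 2 by nat_lia.
rewrite leqNgt; apply/negP=> v3; apply: (@optimal_no_less _ _ _ _ v Hopt Kc Kd le).
by have := dgK v; rewrite eqxx; nat_lia.
Qed.

(** If the start of the leg is removed or moved elsewhere, its second vertex takes
    over, provided that it becomes a leaf. *)
Lemma leg_behead H K l v p : legged H l (v :: p) -> dg K v = 1 ->
  {in v :: p &, subrel H K} ->
  {in p, forall x, x != v -> dg H x <= dg K x} -> dg H v <= 2 -> legged K v p.
Proof.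
move=> [_ /= /andP[_ vp] b3] v1 sub le v2; split=> //.
  by apply: sub_in_path sub _ _ _ vp; apply/allP.
have bv : last v p != v by apply: contraTneq b3 => ->; nat_lia.
apply: leq_trans b3 (le _ _ bv).
by have := mem_last v p; rewrite inE (negbTE bv).
Qed.

(** Otherwise pruning [l] would shorten the leg. *)
Lemma best_has_private H l p : shortest_leg H l p -> exists x, x \in privates H l.
Proof.
move=> sleg; have [Hopt leg Hmin] := sleg; have := leg_uniq sleg.
have [l1 lp b3] := leg; case: p => [|v p] in sleg leg Hmin lp b3 *.
  by rewrite /= l1 in b3.
case/andP: lp => lv vp up; apply/set0Pn; apply/negP=> /eqP no_priv.
have [Kopt dgK v2] := optimal_prune Hopt l1 lv no_priv.
have nlv := csub_neq (opt_csub Hopt) lv.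
suff /(Hmin _ _ _ Kopt) : legged (del_edge l v H) v p by rewrite /= ltnn.
have lN x : x \in v :: p -> x != l.
  by move=> xp; case/andP: up => + _; apply: contraNneq => <-.
apply: (leg_behead leg); rewrite ?v2 //.
- by have := dgK v; rewrite eqxx v2 eq_sym (negbTE nlv); nat_lia.
- by move=> x y /lN xl /lN yl; apply: del_edge_away.
- move=> x xp xv; have := dgK x; rewrite (negbTE xv) (negbTE (lN x _)) ?inE ?xp ?orbT //.
  by nat_lia.
Qed.

(** After prolonging [l] to [x], the leaves [x] and [m] would be adjacent. *)
Lemma extend_common H l m x : optimal G H -> dg H l = 1 -> dg H m = 1 ->
  l != m -> dg H x = 0 -> edge G l x -> edge G m x -> False.
Proof.
move=> Hopt l1 m1 lm x0 lx mx; have [Kopt dgK] := optimal_extend Hopt l1 lx x0.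
have xl : x != l by apply: contra_eq_neq x0 => ->; rewrite l1.
have xm : x != m by apply: contra_eq_neq x0 => ->; rewrite m1.
suff: ~~ edge G m x by rewrite mx.
apply: (optimal_leafs_nonadj Kopt); rewrite ?dgK.
- by rewrite m1 eq_sym (negbTE lm) eq_sym (negbTE xm).
- by rewrite x0 eqxx (negbTE xl).
- by rewrite eq_sym.
Qed.

(** Otherwise pruning [m] would decrease the number of vertices; a private
    neighbour of [l] cannot appear, since two leaves have no common neighbour
    outside [H]. *)
Lemma best_leaf_has_private H l p m : best H l p -> dg H m = 1 ->
  exists x, x \in privates H m.
Proof.
move=> Hbest m1; have [sleg _ Hcard] := Hbest; have [Hopt leg _] := sleg.
have [ml|ml] := eqVneq m l; first by rewrite ml; exact: best_has_private sleg.
apply/set0Pn; apply/negP=> /eqP no_priv.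
have [Hc _ _ _] := Hopt; have [Hsym HG _] := Hc.
have /dg_gt0P[v mv] : 0 < dg H m by rewrite m1.
have [Kopt dgK v2] := optimal_prune Hopt m1 mv no_priv.
set K := del_edge m v H in Kopt dgK.
have nmv := csub_neq Hc mv; have [l1 lp b3] := leg.
have lv : l != v by apply: contra_eq_neq l1 => ->; rewrite v2.
have mNp : m \notin p by apply/negP=> /(leg_dg sleg); rewrite m1.
have Ksleg : shortest_leg K l p.
  apply: shortest_leg_same sleg Kopt _; split.
  - by have := dgK l; rewrite (negbTE lv) eq_sym (negbTE ml); nat_lia.
  - apply: (sub_in_path (P := predC1 m)) lp; first by move=> x y; apply: del_edge_away.
    rewrite /= eq_sym ml; apply/allP=> x xp /=.
    by apply: contraNneq mNp => <-.
  - have := dgK (last l p); case: eqP => [E|_]; first by rewrite E m1 in b3.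
    by case: eqP => [E|_]; [rewrite E v2 in b3 | nat_lia].
have le : #|privates K l| <= #|privates H l|.
  apply/subset_leq_card/subsetP=> x /privatesP[x0 lx only].
  have xm : x != m.
    apply/eqP=> xm; have vl : v = l; last by rewrite vl eqxx in lv.
    apply: only; first by rewrite xm; apply: HG.
    by have := dgK v; rewrite eqxx eq_sym (negbTE nmv) v2; nat_lia.
  have Hx0 : dg H x = 0.
    have := dgK x; rewrite (negbTE xm) x0; case: eqP => [->|_]; last by nat_lia.
    by rewrite v2.
  apply/privatesP; split=> // w xw w0; apply: only => //.
  have := dgK w; case: (eqVneq w m) => [wm|_].
    case: (@extend_common H l m x Hopt l1 m1) => //; first by rewrite eq_sym.
    by rewrite edge_sym -wm.
  by case: eqP => [->|_]; nat_lia.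
have := Hcard K l Ksleg le; apply/negP; rewrite -ltnNge.
apply: proper_card; apply/properP; split.
  by apply/subsetP=> x; rewrite !inE -(dgK x); nat_lia.
exists m; rewrite !inE ?m1 //.
by have := dgK m; rewrite m1 eqxx (negbTE nmv); nat_lia.
Qed.

End Legs.

(** * Prolonging two leaves *)

Section Tips.
Variables (V : finType) (G : sgraph V).
Implicit Types (H K : rel V) (a c l m s x y z : V) (p : seq V).

(** The ends that the leaf [l] can be given by prolonging it by at most two vertices
    outside [H], the first of which is [x]. *)
Definition tip H l x a := a = l \/ a = x \/ dg H a = 0 /\ edge G x a.

Lemma eq_dg H K u : K u =1 H u -> dg K u = dg H u.
Proof. by move=> KH; apply: eq_card => w; rewrite !inE KH. Qed.

Lemma dg_neq H u w : dg H u != dg H w -> u != w.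
Proof. by apply: contra_neq => ->. Qed.

Lemma tip_extend H l x a : optimal G H -> dg H l = 1 -> dg H x = 0 ->
  edge G l x -> tip H l x a ->
  exists K, [/\ optimal G K, dg K a = 1
    & forall u, u != l -> u != x -> u != a -> K u =1 H u].
Proof.
move=> Hopt l1 x0 lx; have xl : x != l by apply: (dg_neq (H := H)); rewrite x0 l1.
case=> [->|]; first by exists H.
have [K1opt dg1] := optimal_extend Hopt l1 lx x0.
set K1 := add_edge l x H in K1opt dg1 *.
have K1x : dg K1 x = 1 by rewrite dg1 x0 eqxx (negbTE xl).
case=> [->|[a0 xa]].
  exists K1; split=> // u ul ux _ w; exact: add_edge_off.
have al : a != l by apply: (dg_neq (H := H)); rewrite a0 l1.
have ax := edge_neq xa.
have K1a : dg K1 a = 0.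
  by rewrite dg1 a0 (negbTE al) eq_sym (negbTE ax).
have [Kopt dgK] := optimal_extend K1opt K1x xa K1a.
exists (add_edge x a K1); split=> //.
  by rewrite dgK K1a eqxx eq_sym (negbTE ax).
by move=> u ul ux ua w; rewrite /K1 !add_edge_off.
Qed.

(** Both leaves are prolonged at the same time; the inequalities keep the two
    prolongations disjoint. *)
Lemma tips_extend H l m x y a c : optimal G H ->
  dg H l = 1 -> dg H m = 1 -> l != m ->
  x \in privates G H l -> y \in privates G H m ->
  tip H l x a -> tip H m y c -> a != y -> c != x -> a != c ->
  exists K, [/\ optimal G K, dg K a = 1, dg K c = 1 &
    forall u, u != l -> u != x -> u != a -> u != m -> u != y -> u != c ->
      K u =1 H u].
Proof.
move=> Hopt l1 m1 lm /privatesP[x0 lx xl] /privatesP[y0 my ym] ta tc ay cx ac.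
have neq01 u w : dg H u = 0 -> dg H w = 1 -> u != w.
  by move=> u0 w1; apply: (dg_neq (H := H)); rewrite u0 w1.
have yx : y != x.
  apply: contraNneq lm => yx; rewrite -(xl m) ?m1 //.
  by rewrite -yx edge_sym.
have am : a != m.
  by case: ta => [->//|[->|[a0 _]]]; apply: neq01.
have cl : c != l.
  by case: tc => [->|[->|[c0 _]]]; rewrite 1?eq_sym // eq_sym neq01.
have [K1 [K1opt a1 K1H]] := tip_extend Hopt l1 x0 lx ta.
have K1m : dg K1 m = 1.
  by rewrite (eq_dg (K1H _ _ _ _)) // 1?eq_sym // neq01.
have K1y : dg K1 y = 0.
  by rewrite (eq_dg (K1H _ _ _ _)) // 1?eq_sym // eq_sym neq01.
have tc1 : tip K1 m y c.
  case: tc => [->|[->|[c0 yc]]]; [by left|by right; left|right; right; split=> //].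
  by rewrite (eq_dg (K1H _ _ _ _)) // eq_sym.
have [K [Kopt c1 KK1]] := tip_extend K1opt K1m K1y my tc1.
exists K; split=> // [|u ul ux ua um uy uc w]; first by rewrite (eq_dg (KK1 _ _ _ _)).
by rewrite KK1 // K1H.
Qed.

(** The tips are treated in order of length: at each stage non-adjacency of the
    shorter tips is what makes the prolongations disjoint. *)
Lemma tips_far H l m x y a c : optimal G H ->
  dg H l = 1 -> dg H m = 1 -> l != m ->
  x \in privates G H l -> y \in privates G H m ->
  tip H l x a -> tip H m y c ->
  [/\ a != y, c != x, a != c & ~~ edge G a c].
Proof.
move=> Hopt l1 m1 lm xP yP ta tc.
have nonadj a' c' : tip H l x a' -> tip H m y c' -> a' != y -> c' != x ->
    a' != c' -> ~~ edge G a' c'.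
  move=> ta' tc' ay cx ac.
  have [K [Kopt a1 c1 _]] := tips_extend Hopt l1 m1 lm xP yP ta' tc' ay cx ac.
  exact: optimal_leafs_nonadj Kopt a1 c1 ac.
have [x0 lx xl] := privatesP _ _ _ _ xP; have [y0 my ym] := privatesP _ _ _ _ yP.
have neq01 u w : dg H u = 0 -> dg H w = 1 -> u != w.
  by move=> u0 w1; apply: (dg_neq (H := H)); rewrite u0 w1.
have tx : tip H l x x by right; left.
have ty : tip H m y y by right; left.
have xy : x != y.
  apply: contraNneq lm => xy; rewrite -(xl m) ?m1 //.
  by rewrite xy edge_sym.
have nxy : ~~ edge G x y by apply: nonadj; rewrite // eq_sym.
have ay : a != y.
  case: ta => [->|[->//|[a0 xa]]]; first by rewrite eq_sym neq01.
  by apply: contraNneq nxy => <-.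
have cx : c != x.
  case: tc => [->|[->|[c0 yc]]]; [by rewrite eq_sym neq01| by rewrite eq_sym |].
  by apply: contraNneq nxy => <-; rewrite edge_sym.
suff ac : a != c by split=> //; apply: nonadj.
apply/eqP=> ac; case: (ta) => [al|[ax|[a0 xa]]].
- case: tc => [cm|[cy|[c0 _]]]; first by rewrite -al -cm ac eqxx in lm.
    by rewrite -cy ac eqxx in ay.
  by rewrite -ac al l1 in c0.
- by rewrite -ac ax eqxx in cx.
- case: (tc) => [cm|[cy|[c0 yc]]]; first by rewrite ac cm m1 in a0.
    by rewrite ac cy eqxx in ay.
  have yx : y != x by rewrite eq_sym.
  by have := nonadj a y ta ty ay yx ay; rewrite ac edge_sym yc.
Qed.

(** Inserting [a] in the edge [zs] keeps the excess and the leg, but puts a second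
    neighbour of [x] in the subgraph. *)
Lemma best_no_insertion H l p x z s a : best G H l p -> x \in privates G H l ->
  edge G x a -> dg H a = 0 -> H z s -> s \notin l :: p ->
  edge G z a -> edge G a s -> False.
Proof.
move=> Hbest xP xa a0 zs; rewrite inE negb_or => /andP[sl sNp] za as_.
have [sleg Hpriv _] := Hbest; have [Hopt [l1 lp b3] _] := sleg.
have [Hc Hd _ _] := Hopt; have [Kc dgK] := subdivide Hc zs a0 za as_.
set K := del_edge z s _ in Kc dgK.
have le u : dg K u - 2 <= dg H u - 2.
  by rewrite dgK; case: eqP => [->|]; nat_lia.
have Kopt : optimal G K.
  apply: optimal_same Hopt Kc _ le.
  by apply: dominating_sub Hd _ => u; rewrite dgK; nat_lia.
have al : a != l by apply: (dg_neq (H := H)); rewrite a0 l1.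
have ba : last l p != a by apply: contraTneq b3 => ->; rewrite a0.
have Ksleg : shortest_leg G K l p.
  apply: shortest_leg_same sleg Kopt _; split.
  - by rewrite dgK l1 eq_sym (negbTE al).
  - apply: (sub_in_path (P := predC1 s)) lp.
      move=> u w us ws uw; rewrite /K del_edgeC; apply: del_edge_away => //.
      by do 2!apply: add_edge_sub.
    rewrite /= eq_sym sl; apply/allP=> u up /=.
    by apply: contraNneq sNp => <-.
  - by rewrite dgK (negbTE ba) muln0 addn0.
have := Hpriv K l Ksleg; apply/negP; rewrite -ltnNge.
have [x0 lx xl] := privatesP _ _ _ _ xP.
apply: proper_card; apply/properP; split; last first.
  exists x => //; apply/privatesP=> -[_ _ /(_ a xa)].
  by rewrite dgK eqxx a0 => /(_ isT)/eqP; rewrite (negbTE al).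
apply/subsetP=> u /privatesP[u0 lu ul]; apply/privatesP; split=> //.
  by move: u0; rewrite dgK; case: (dg H u).
by move=> w uw w0; apply: ul; rewrite // dgK addn_gt0 w0.
Qed.

(** Moving the leaf [l] into the edge [zs] keeps the vertex set and makes its old
    neighbour the start of a shorter leg. *)
Lemma leg_no_relocation H l p z s : shortest_leg G H l p ->
  H z s -> s \notin l :: p -> edge G z l -> edge G l s -> False.
Proof.
move=> sleg zs sNp zl ls; have [Hopt leg Hmin] := sleg.
have [Hc Hd _ _] := Hopt; have [Hsym HG _] := Hc; have up := leg_uniq sleg.
have [l1 lp b3] := leg; case: p => [|v p] in sleg leg Hmin lp b3 sNp up *.
  by rewrite /= l1 in b3.
case/andP: lp => lv vp; move: sNp; rewrite !inE !negb_or => /and3P[sl sv sNp].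
have nlv := csub_neq Hc lv; have dg1 u := dg_del_edge u Hsym nlv lv.
set H1 := del_edge l v H in dg1.
have H1c : connected_sub G H1 by apply: connected_sub_prune.
have H1l : dg H1 l = 0 by have := dg1 l; rewrite eqxx l1 (negbTE nlv); nat_lia.
have zs1 : H1 z s.
  by apply: del_edge_away => //; exact: edge_neq zl.
have [Kc dgK] := subdivide H1c zs1 H1l zl ls.
set K := del_edge z s _ in Kc dgK.
have v2 : 2 <= dg H v by apply: leg_dg sleg _; rewrite inE eqxx.
have le u : dg K u - 2 <= dg H u - 2.
  rewrite dgK -dg1; case: eqP => [->|_]; last by nat_lia.
  by rewrite H1l.
have Kd : dominating G K.
  apply: dominating_sub Hd _ => u; rewrite dgK -dg1.
  have [->|_] := eqVneq u v; last by nat_lia.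
  by have := dg1 v; rewrite eqxx eq_sym (negbTE nlv); nat_lia.
have Kopt := optimal_same Hopt Kc Kd le.
have Kv : dg K v + 1 = dg H v.
  by have := dg1 v; rewrite dgK eqxx eq_sym (negbTE nlv); nat_lia.
have v_le : dg H v <= 2.
  rewrite leqNgt; apply/negP=> v3.
  by apply: (@optimal_no_less _ _ _ _ v Hopt Kc Kd le); nat_lia.
suff /(Hmin _ _ _ Kopt) : legged K v p by rewrite /= ltnn.
have lN x : x \in v :: p -> x != l.
  by move=> xp; case/andP: up => + _; apply: contraNneq => <-.
have sN x : x \in v :: p -> x != s.
  by apply: contraTneq => ->; rewrite inE negb_or sv.
apply: (leg_behead leg) => //.
- by nat_lia.
- move=> x y /[dup] /lN xl /sN xs /[dup] /lN yl /sN ys xy; rewrite /K del_edgeC.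
  by apply: del_edge_away => //; do 2!apply: add_edge_sub; apply: del_edge_away.
- move=> x xp xv; have := dg1 x; rewrite dgK (negbTE xv).
  by rewrite (negbTE (lN x _)) ?inE ?xp ?orbT //; nat_lia.
Qed.

(** With [z1 z2] in place of the path [z1 s z2], the vertex [s] is free to serve as
    a prolongation of the leaf [a], and it is adjacent to the leaf [c]. *)
Lemma optimal_no_bypass K a c s z1 z2 : optimal G K ->
  dg K a = 1 -> dg K c = 1 -> a != c -> dg K s = 2 ->
  K s z1 -> K s z2 -> z1 != z2 -> edge G z1 z2 -> edge G a s -> edge G s c ->
  False.
Proof.
move=> Kopt a1 c1 ac s2 sz1 sz2 z12 gz12 as_ sc.
have [Kc Kd _ _] := Kopt; have [Ksym KG _] := Kc.
have [nsz1 nsz2] := (csub_neq Kc sz1, csub_neq Kc sz2).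
have nKz : ~~ K z1 z2.
  apply: contraTN sz1 => /(optimal_bridges Kopt)/negP nb; apply/negP=> sz1; apply: nb.
  apply: (@connect_trans _ _ s); apply: connect1; rewrite /del_edge.
    by rewrite Ksym sz1 (negbTE z12) (negbTE nsz2) andbF.
  by rewrite sz2 (negbTE nsz1) (negbTE nsz2).
have dg1 u := dg_add_edge u Ksym z12 nKz.
set K1 := add_edge z1 z2 K in dg1.
have K1sym : symmetric K1 by apply: add_edge_sym.
have K1c : connected_sub G K1.
  by apply: connected_sub_add => //; apply: (@dg_gt0 _ _ _ s); rewrite Ksym.
have K1sz1 : K1 s z1 by apply: add_edge_sub.
have K1sz2 : K1 s z2 by apply: add_edge_sub.
have dg2 u := dg_del_edge u K1sym nsz1 K1sz1.
set K2 := del_edge s z1 K1 in dg2.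
have K2sym : symmetric K2 by apply: del_edge_sym.
have K2sz2 : K2 s z2.
  by rewrite /K2 /del_edge K1sz2 eq_sym (negbTE z12) (negbTE nsz1) andbF.
have K2c : connected_sub G K2.
  apply: connected_sub_del => //; apply: connect_trans (connect1 K2sz2) (connect1 _).
  rewrite /K2 /del_edge K1sym /K1 add_edge_new /=.
  by rewrite (eq_sym z2 s) (negbTE nsz2) eq_sym (negbTE z12).
have dg3 u := dg_del_edge u K2sym nsz2 K2sz2.
set K3 := del_edge s z2 K2 in dg3.
have sE : (s == z1 = false) * (s == z2 = false) by rewrite !(negbTE nsz1, negbTE nsz2).
have K3c : connected_sub G K3.
  apply: connected_sub_prune => //.
  by have := dg1 s; have := dg2 s; rewrite !eqxx !sE s2; nat_lia.
have dg3' u : dg K3 u + 2 * (u == s) = dg K u.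
  by have := dg1 u; have := dg2 u; have := dg3 u; nat_lia.
have K3s : dg K3 s = 0 by have := dg3' s; rewrite eqxx s2; nat_lia.
have sa : (a == s) = false by apply: contra_eqF a1 => /eqP->; rewrite s2.
have cs : (c == s) = false by apply: contra_eqF c1 => /eqP->; rewrite s2.
have K3a : dg K3 a = 1 by have := dg3' a; rewrite sa a1; nat_lia.
have nas := edge_neq as_.
have nK3 : ~~ K3 a s.
  by apply/negP=> as3; have := csub_dgr K3c as3; rewrite K3s.
have dg4 u := dg_add_edge u (csub_sym K3c) nas nK3.
set K4 := add_edge a s K3 in dg4.
have K4c : connected_sub G K4 by apply: connected_sub_add; rewrite ?K3a.
have K4opt : optimal G K4.
  apply: optimal_same Kopt K4c _ _.
    apply: dominating_sub Kd _ => u; rewrite dg4 -dg3'.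
    by case: (u == s); nat_lia.
  move=> u; rewrite dg4 -dg3'; have [->|_] := eqVneq u s; first by rewrite K3s; nat_lia.
  by have [->|_] := eqVneq u a; rewrite ?K3a; nat_lia.
have K4s : dg K4 s = 1 by rewrite dg4 K3s eqxx eq_sym sa.
have K4c1 : dg K4 c = 1.
  by have := dg3' c; rewrite dg4 cs eq_sym (negbTE ac) c1; nat_lia.
by have := optimal_leafs_nonadj K4opt K4s K4c1; rewrite eq_sym cs sc => /(_ isT).
Qed.

End Tips.

(** * Distance and degree sum of two private vertices *)

(** A step may stay in place, so three intermediate vertices describe all walks of
    length at most four. *)
Definition within4 (V : finType) (G : sgraph V) x y := exists a s c,
  [/\ x = a \/ edge G x a, a = s \/ edge G a s,
      s = c \/ edge G s c & c = y \/ edge G c y].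

Section Distance.
Variables (V : finType) (G : sgraph V).
Hypothesis G_claw_free : claw_free G.
Implicit Types (H K : rel V) (a c l m s x y z : V) (p : seq V).

(** At most one neighbour of [s] leads to [a] and at most one to [c], so a third
    neighbour [z] leads to neither.  By claw-freeness one of the leaves is adjacent
    to [z], and rotating it onto [z] cuts [zs] at the branch vertex [s]. *)
Lemma optimal_tips_no_branch K a c s : optimal G K ->
  dg K a = 1 -> dg K c = 1 -> a != c -> 3 <= dg K s ->
  edge G a s -> edge G s c -> False.
Proof.
move=> Kopt a1 c1 ac s3 as_ sc; have [Kc _ _ _] := Kopt; have [Ksym KG _] := Kc.
have nac := optimal_leafs_nonadj Kopt a1 c1 ac.
have Kbr := optimal_bridges Kopt; have sym u v := sym_connect_sym (del_edge_sym u v Ksym).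
have tow r : dg K r = 1 -> s != r -> exists w, toward K r s w.
  move=> r1; apply: toward_exists; apply: optimal_connect Kopt _ _; last by rewrite r1.
  exact: leq_trans s3.
have sa : s != a by rewrite eq_sym (edge_neq as_).
have [za ta] := tow a a1 sa; have [zc tc] := tow c c1 (edge_neq sc).
have [z [sz zza zzc]] := dg_third za zc s3.
have rot r zr : dg K r = 1 -> s != r -> toward K r s zr -> z != zr ->
    edge G r z -> False.
  move=> r1 sr tr zzr rz; have rs : r != s by rewrite eq_sym.
  suff cut : connect (del_edge z s K) r s.
    have zs : K z s by rewrite Ksym.
    have [_ _ s2] : [/\ _, _ & _] := optimal_rotate Kopt r1 rz zs rs cut.
    by rewrite s2 in s3.
  rewrite (eq_connect (del_edgeC z s K)) sym.
  have: connect K s r by apply: optimal_connect Kopt _ _; [exact: leq_trans s3 | rewrite r1].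
  case/(cut_sides z) => // zr'; have tz : toward K r s z by rewrite /toward sz.
  by rewrite (toward_unique Ksym Kbr tr tz) eqxx in zzr.
have leaf_neq r zr : dg K r = 1 -> toward K r s zr -> z != zr -> s != r -> r != z.
  move=> r1 tr zzr sr; apply: contraNneq zzr => rz; apply/eqP.
  apply: toward_unique Ksym Kbr _ tr.
  by rewrite /toward sz rz connect0.
have az := leaf_neq a za a1 ta zza sa.
have cz := leaf_neq c zc c1 tc zzc (edge_neq sc).
have sa' : edge G s a by rewrite edge_sym.
have := claw_freeP G_claw_free sa' sc (KG _ _ sz) ac az cz.
rewrite (negbTE nac) /= => /orP[az'|cz'].
  exact: (rot a za).
exact: (rot c zc c1 (edge_neq sc)).
Qed.

(** The vertices [a] and [c] next to the ends of such a lazy walk are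
    tips, and the middle [s] is a common neighbour of both; every position of [s]
    is excluded by one of the preceding moves. *)
Lemma best_privates_far H l p m x y : best G H l p ->
  dg H m = 1 -> m != l -> x \in privates G H l -> y \in privates G H m ->
  ~ within4 G x y.
Proof.
move=> Hbest m1 ml xP yP [a [s [c [xa as_ sc cy]]]]; have [sleg _ _] := Hbest.
have [Hopt [l1 lp b3] _] := sleg.
have [Hc Hd _ _] := Hopt; have [Hsym HG _] := Hc.
have lm : l != m by rewrite eq_sym.
have [x0 lx xl] := privatesP _ _ _ _ xP; have [y0 my ym] := privatesP _ _ _ _ yP.
have ta : tip G H l x a.
  case: xa => [->|xa]; first by right; left.
  by have [a0|/(xl _ xa)->] := posnP (dg H a); [right; right | left].
have tc : tip G H m y c.
  case: cy => [->|cy]; first by right; left.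
  rewrite edge_sym in cy.
  by have [c0|/(ym _ cy)->] := posnP (dg H c); [right; right | left].
have tl : tip G H l x l by left.
have tx : tip G H l x x by right; left.
have tm : tip G H m y m by left.
have ty : tip G H m y y by right; left.
have far u w tu tw := tips_far (a := u) (c := w) Hopt l1 m1 lm xP yP tu tw.
have [ay cx ac nac] := far a c ta tc.
have {}as_ : edge G a s.
  case: as_ => // as_; case: sc => [sc|]; last by rewrite -as_ (negbTE nac).
  by rewrite as_ sc eqxx in ac.
have {}sc : edge G s c by case: sc => // sc; rewrite -sc as_ in nac.
have sl : s != l by apply: contraTneq sc => ->; case: (far l c tl tc).
have sx : s != x by apply: contraTneq sc => ->; case: (far x c tx tc).
have sm : s != m by apply: contraTneq as_ => ->; case: (far a m ta tm).
have sy : s != y by apply: contraTneq as_ => ->; case: (far a y ta ty).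
have sa : s != a by rewrite eq_sym (edge_neq as_).
have sc' := edge_neq sc.
have [K [Kopt a1 c1 KH]] := tips_extend Hopt l1 m1 lm xP yP ta tc ay cx ac.
have KHs : K s =1 H s by apply: KH.
have dgs := eq_dg KHs.
(* Outside the subgraph, [s] would prolong [a] and be a leaf adjacent to [c]. *)
have [s0|s_gt0] := posnP (dg H s).
  rewrite s0 in dgs; have [K'opt dgK'] := optimal_extend Kopt a1 as_ dgs.
  have s1 : dg (add_edge a s K) s = 1 by rewrite dgK' dgs eqxx (negbTE sa).
  have c1' : dg (add_edge a s K) c = 1.
    by rewrite dgK' c1 eq_sym (negbTE ac) eq_sym (negbTE sc').
  by have := optimal_leafs_nonadj K'opt s1 c1' sc'; rewrite sc.
have [s3|s2] := leqP 3 (dg H s).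
  by rewrite -dgs in s3; apply: optimal_tips_no_branch Kopt a1 c1 ac s3 as_ sc.
have {}s2 : dg H s = 2.
  have s1 : dg H s <> 1; last by nat_lia.
  rewrite -dgs => s1; have := optimal_leafs_nonadj Kopt a1 s1.
  by rewrite as_ eq_sym => /(_ sa).
(* Prolonging [m] alone leaves the leg of [l] as it is. *)
have [sp|sNp] := boolP (s \in p).
  have [K1 [K1opt K1c K1H]] := tip_extend Hopt m1 y0 my tc.
  have cl : c != l.
    apply: contraTneq sc => cl; rewrite edge_sym cl; apply/negP=> ls.
    by case: (far l c tl tc) => _ _; rewrite cl eqxx.
  have rows u : u \in l :: p -> K1 u =1 H u.
    have off w : dg H w <= 1 -> w != l -> w \notin l :: p.
      move=> w1 wl; rewrite inE negb_or wl; apply/negP=> /(leg_dg sleg).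
      by rewrite leqNgt ltnS w1.
    move=> up; apply: K1H; apply: contraTneq up => ->; apply: off => //.
    - by rewrite m1.
    - by rewrite y0.
    - by apply: (dg_neq (H := H)); rewrite y0 l1.
    - by case: tc => [->|[->|[-> _]]]; rewrite ?m1 ?y0.
  have bp : last l p \in l :: p by apply: mem_last.
  have K1leg : legged K1 l p.
    split; rewrite ?(eq_dg (rows _ _)) ?inE ?eqxx //.
    apply: (sub_in_path (P := mem (l :: p))) lp; last by apply/allP.
    by move=> u w up wp; rewrite rows.
  apply: (leg_no_chord (shortest_leg_same sleg K1opt K1leg) K1c cl sp).
    by rewrite (eq_dg (rows s _)) // inE sp orbT.
  by rewrite edge_sym.
have sNlp : s \notin l :: p by rewrite inE negb_or sl.
have [z1 [z2 [sz1 sz2 z12]]] := dg2P s2.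
(* If [a] were a neighbour of [s] in [H] it would be [l], and [s] would be on the
   leg. *)
have a_neq z : H s z -> a != z.
  move=> sz; apply/eqP=> az; have z0 := csub_dgr Hc sz.
  have zl : z = l.
    case: ta => [<-//|[ax|[a0 _]]]; first by rewrite -az ax x0 in z0.
    by rewrite -az a0 in z0.
  case: p => [|v p] in Hbest sleg lp b3 sNp sNlp *; first by rewrite /= l1 in b3.
  case/andP: lp => lv _; rewrite zl Hsym in sz.
  by rewrite (dg1_eq l1 lv sz) inE eqxx in sNp.
have no_insert z : H s z -> edge G a z -> False.
  move=> sz az; have zs : H z s by rewrite Hsym.
  rewrite edge_sym in az; case: ta => [al|[ax|[a0 xa0]]].
  - rewrite al in az as_; exact: leg_no_relocation sleg zs sNlp az as_.
  - by rewrite (xl s) ?eqxx // in sl; rewrite -ax.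
  - exact: best_no_insertion Hbest xP xa0 a0 zs sNlp az as_.
have sa' : edge G s a by rewrite edge_sym.
have := claw_freeP G_claw_free sa' (HG _ _ sz1) (HG _ _ sz2) (a_neq _ sz1) (a_neq _ sz2) z12.
case/or3P=> [/(no_insert _ sz1)//|/(no_insert _ sz2)//|z12'].
by apply: (optimal_no_bypass Kopt a1 c1 ac _ _ _ z12 z12' as_ sc); rewrite ?dgs ?KHs.
Qed.

(** Two leaves with the same neighbour [b] are not adjacent, so by claw-freeness one
    of them would be adjacent to a third neighbour of [b], and rotating it there
    would lower the degree of the branch vertex [b]. *)
Lemma optimal_leaf_parents H : optimal G H ->
  2 * #|leafs H| <= #|[set x | 0 < dg H x]|.
Proof.
move=> Hopt; have [Hc _ _ _] := Hopt; have [Hsym HG _] := Hc.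
have Hbr := optimal_bridges Hopt.
pose f v := odflt v [pick w | H v w].
have fP v : v \in leafs H -> H v (f v).
  rewrite inE /f => /eqP v1; case: pickP => //= no.
  have /dg_gt0P[w vw] : 0 < dg H v by rewrite v1.
  by have := no w; rewrite vw.
have f2 v : v \in leafs H -> 2 <= dg H (f v).
  move=> vL; have vf := fP v vL; have := csub_dgr Hc vf.
  have f1 : dg H (f v) <> 1; last by nat_lia.
  move=> f1; rewrite inE in vL.
  have := optimal_leafs_nonadj Hopt (eqP vL) f1 (csub_neq Hc vf).
  by rewrite (HG _ _ vf).
have f_inj : {in leafs H &, injective f}.
  move=> v w vL wL fvw; apply/eqP; apply: contraT => vw.
  have [vf wf] := (fP v vL, fP w wL); rewrite -fvw in wf.
  move: (f2 v vL); set b := f v in vf wf * => b2.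
  have v1 : dg H v = 1 by apply/eqP; rewrite inE in vL.
  have w1 : dg H w = 1 by apply/eqP; rewrite inE in wL.
  have bv : H b v by rewrite Hsym.
  have bw : H b w by rewrite Hsym.
  have nvw := optimal_leafs_nonadj Hopt v1 w1 vw.
  have [b3|b_le2] := leqP 3 (dg H b).
    have [c [bc cv cw]] := dg_third v w b3.
    have rot r : H b r -> dg H r = 1 -> c != r -> edge G r c -> False.
      move=> br r1 cr rc; have cb : H c b by rewrite Hsym.
      have rb := csub_neq Hc br.
      have [||_ _ b2'] := optimal_rotate Hopt r1 rc cb; first by rewrite eq_sym.
        apply: connect1; rewrite /del_edge Hsym br /= eq_sym (negbTE cr) /=.
        by rewrite eq_sym (negbTE rb).
      by rewrite b2' in b3.
    have [vc wc] : v != c /\ w != c by rewrite ![_ == c]eq_sym.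
    have := claw_freeP G_claw_free (HG _ _ bv) (HG _ _ bw) (HG _ _ bc) vw vc wc.
    rewrite (negbTE nvw) /= => /orP[vc'|wc'].
      by case: (rot v bv v1 cv).
    by case: (rot w bw w1 cw).
  have [b' b'3] := excess_gt0P _ (opt_pos Hopt).
  have closed x y : H x y -> pred3 v b w x -> pred3 v b w y.
    move=> xy /or3P[] /eqP xE; rewrite {x}xE in xy.
    + by rewrite /= (dg1_eq v1 vf xy) eqxx orbT.
    + by have := dg2_eq b_le2 bv bw vw xy; case/orP=> /eqP->; rewrite /= eqxx ?orbT.
    + by rewrite /= (dg1_eq w1 wf xy) eqxx orbT.
  have vb' : connect H v b'.
    by apply: optimal_connect Hopt _ _; [rewrite v1 | exact: leq_trans b'3].
  have := connect_closed_under closed vb'; rewrite /= eqxx => /(_ isT).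
  by case/or3P=> /eqP bE; move: b'3; rewrite bE ?v1 ?w1 // ltnNge -ltnS b_le2.
have disj : [disjoint leafs H & f @: leafs H].
  apply/pred0P=> u /=; apply/negP=> /andP[uL /imsetP[v vL uE]].
  by have := f2 v vL; rewrite -uE; move: uL; rewrite inE => /eqP->.
rewrite mul2n -addnn -{2}(card_in_imset f_inj).
rewrite -cardsUI (disjoint_setI0 disj) cards0 addn0.
apply/subset_leq_card/subsetP=> u; rewrite !inE => /orP[/eqP->//|/imsetP[v vL ->]].
exact: ltnW (f2 v vL).
Qed.

Lemma best_degree_sum H l p : best G H l p ->
  exists x y, [/\ x != y,
    ~ within4 G x y & dg (edge G) x + dg (edge G) y + 3 * excess H + 4 <= #|V|].
Proof.
move=> Hbest; have [sleg _ _] := Hbest; have [Hopt [l1 lp b3] _] := sleg.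
have [Hc Hd Hp _] := Hopt; have [Hsym HG _] := Hc.
have Lge := excess_le_leafs Hc (optimal_bridges Hopt) Hp.
have Age := optimal_leaf_parents Hopt.
set L := leafs H in Lge Age; set A := [set _ | _] in Age.
have lL : l \in L by rewrite inE l1.
have [m mL ml] : exists2 m, m \in L & m != l.
  have : 0 < #|L :\ l| by have := cardsD1 l L; rewrite lL; nat_lia.
  by case/card_gt0P=> m; rewrite inE in_set1 => /andP[]; exists m.
pose g v := odflt v [pick x in privates G H v].
have gP v : v \in L -> g v \in privates G H v.
  rewrite inE => /eqP v1; rewrite /g; case: pickP => //= no.
  by have [x] := best_leaf_has_private Hbest v1; rewrite no.
have g_dg v : v \in L -> dg H (g v) = 0 by move=> /gP/privatesP[].
have g_only v w : v \in L -> edge G (g v) w -> 0 < dg H w -> w = v.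
  by move=> /gP/privatesP[_ _]; apply.
have g_inj : {in L &, injective g}.
  move=> v w vL wL gvw; apply: esym; apply: (g_only v) => //.
    by rewrite gvw; case/gP/privatesP: wL => _ + _; rewrite edge_sym.
  by move: wL; rewrite inE => /eqP->.
have g_far v w : v \in L -> w \in L -> v != w -> ~~ edge G (g v) (g w).
  move=> vL wL vw; have [v1 w1] : dg H v = 1 /\ dg H w = 1.
    by move: vL wL; rewrite !inE => /eqP-> /eqP->.
  have tv : tip G H v (g v) (g v) by right; left.
  have tw : tip G H w (g w) (g w) by right; left.
  by have [] := tips_far Hopt v1 w1 vw (gP v vL) (gP w wL) tv tw.
pose x := g l; pose y := g m.
have far : ~ within4 G x y.
  have m1 : dg H m = 1 by move: mL; rewrite inE => /eqP.
  exact: best_privates_far Hbest m1 ml (gP l lL) (gP m mL).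
exists x, y; split=> //.
  by apply/eqP=> xy; apply: far; exists x, x, x; split; left.
pose Nx := [set u | edge G x u]; pose Ny := [set u | edge G y u].
(* [P] contains [x] and [y], so their open neighbourhoods are the ones to count. *)
pose A' := A :\ l :\ m; pose P := g @: L.
have cA' : #|A'| + 2 = #|A|.
  rewrite (cardsD1 l A) (cardsD1 m (A :\ l)) !inE ml l1.
  by move: mL; rewrite inE => /eqP->; rewrite /A'; clear; lia.
have cP : #|P| = #|L| by rewrite card_in_imset.
suff : #|Nx| + #|Ny| + #|A'| + #|P| <= #|V|.
  by rewrite /dg -/Nx -/Ny; nat_lia.
rewrite -!sum1_card !(big_mkcond (fun u => u \in _)) /= -!big_split /=.
apply: leq_sum => u _.
have nbr_supp v : v \in L -> edge G (g v) u -> u \in A -> u = v.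
  by rewrite [u \in A]inE; apply: g_only.
have nbr_P v : v \in L -> edge G (g v) u -> u \notin P.
  move=> vL; apply: contraTN => /imsetP[w wL ->].
  by have [->|vw] := eqVneq v w; [rewrite edge_irrefl | apply: g_far].
have NxA : u \in Nx -> u \notin A'.
  rewrite inE => xu; rewrite !in_setD1; apply/negP=> /and3P[_ ul uA].
  by rewrite (nbr_supp l lL xu uA) eqxx in ul.
have NyA : u \in Ny -> u \notin A'.
  rewrite inE => yu; rewrite !in_setD1; apply/negP=> /and3P[um _ uA].
  by rewrite (nbr_supp m mL yu uA) eqxx in um.
have NxP : u \in Nx -> u \notin P by rewrite inE; apply: nbr_P.
have NyP : u \in Ny -> u \notin P by rewrite inE; apply: nbr_P.
have PA : u \in P -> u \notin A'.
  case/imsetP=> v vL ->; rewrite !in_setD1 [_ \in A]inE (g_dg v vL).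
  by rewrite !andbF.
have NxNy : u \in Nx -> u \notin Ny.
  rewrite !inE => xu; apply/negP=> yu; apply: far; exists u, u, u.
  by split; [right | left | left | right; rewrite edge_sym].
case: ifP => [/[dup] /NxA/negbTE-> /[dup] /NxP/negbTE-> /NxNy/negbTE->//|_].
case: ifP => [/[dup] /NyA/negbTE-> /NyP/negbTE->//|_].
by case: ifP => [uA|_]; case: ifP => [/PA|//]; rewrite ?uA.
Qed.

End Distance.

(** * From subgraphs to stems *)

Import Order.TTheory GRing.Theory Num.Theory.

Section Spanning.
Variables (V : finType) (G : sgraph V).
Implicit Types (H K : rel V) (x y z : V).

Lemma leq_dg H K x : subrel K H -> dg K x <= dg H x.
Proof. by move=> KH; apply/subset_leq_card/subsetP=> y; rewrite !inE; apply: KH. Qed.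

(** A connected subgraph with the least total degree has no cycle. *)
Lemma exists_spanning_tree H : 0 < #|V| -> subrel H (edge G) ->
  symmetric H -> (forall x y, connect H x y) ->
  exists2 T : sgraph V, spanning_tree G T & subrel (edge T) H.
Proof.
move=> V0 HG Hsym Hconn.
have [K [Ksym KH Kconn] Kmin] : exists2 K : rel V,
    [/\ symmetric K, subrel K H & forall x y, connect K x y] &
    forall K' : rel V, [/\ symmetric K', subrel K' H & forall x y, connect K' x y] ->
      \sum_v dg K v <= \sum_v dg K' v.
  apply: (ex_least (P := fun K : rel V =>
    [/\ symmetric K, subrel K H & forall x y, connect K x y]) (fun K => \sum_v dg K v)).
  by exists H; split.
have Kirr : irreflexive K.
  by move=> x; apply/negP=> /KH/HG; rewrite edge_irrefl.
exists (SGraph Ksym Kirr) => //; split; last by move=> x y /KH/HG.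
split=> // -[|x [|y q]] //= q0 /andP[/= /andP[xy]].
rewrite rcons_path => /andP[yq qx] /and3P[xNyq yNq _].
case: q => [|z q] // in q0 yq qx xNyq yNq *.
have nxy : x != y by apply: contraNneq xNyq => ->; rewrite inE eqxx.
pose K' := del_edge x y K; have K'sym : symmetric K' by apply: del_edge_sym.
have away u v : u \in y :: z :: q -> v \in y :: z :: q -> K u v -> K' u v.
  move=> uq vq; apply: del_edge_away; first by apply: contraNneq xNyq => <-.
  by apply: contraNneq xNyq => <-.
have yx : connect K' y x.
  apply: (@connect_trans _ _ (last z q)).
    apply/connectP; exists (z :: q) => //.
    apply: (sub_in_path (P := mem (y :: z :: q))) yq; first by move=> u v; apply: away.
    by apply/allP.
  apply: connect1; rewrite /K' del_edgeC; apply: del_edge_away => //.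
  by apply: contraNneq yNq => <-; apply: mem_last.
have K'conn u v : connect K' u v.
  apply: connect_sub (Kconn u v) => a b ab.
  case: (boolP (K' a b)) => [/connect1//|]; rewrite /K' /del_edge ab negbK.
  by case/orP=> /andP[/eqP-> /eqP->] //; rewrite (sym_connect_sym K'sym).
have K'P : [/\ symmetric K', subrel K' H & forall u v, connect K' u v].
  by split=> // u v /del_edge_sub/KH.
have dgE u := dg_del_edge u Ksym nxy xy.
have := Kmin K' K'P; rewrite leqNgt => /negP; apply.
rewrite (bigD1 x) // [X in _ < X](bigD1 x) //=.
have := dgE x; rewrite eqxx (negbTE nxy) addn0 addn1 => <-.
by rewrite addSn ltnS leq_add2l; apply: leq_sum => u _; apply/leq_dg/del_edge_sub.
Qed.

(** A vertex missed by [H] hangs on one vertex of [H] only, so it is a leaf of the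
    tree and the stem has no edges outside [H]. *)
Lemma stem_branches_le_excess H : 0 < #|V| -> connected_sub G H ->
  dominating G H ->
  exists T : sgraph V, spanning_tree G T /\ #|branch_vertices (stem T)| <= excess H.
Proof.
move=> V0 Hc Hd; have [Hsym HG Hconn] := Hc.
pose par x := odflt x [pick y | edge G x y && (0 < dg H y)].
have parP x : dg H x = 0 -> edge G x (par x) && (0 < dg H (par x)).
  move=> x0; rewrite /par; case: pickP => //= no.
  by have [y xy y0] := Hd x x0; have := no y; rewrite xy y0.
pose pend x y := (dg H x == 0) && (y == par x).
pose H2 : rel V := fun x y => [|| H x y, pend x y | pend y x].
have H2sym : symmetric H2 by move=> x y; rewrite /H2 Hsym [pend x y || _]orbC.
have pendG x y : pend x y -> edge G x y.
  by case/andP=> /eqP/parP/andP[xp _] /eqP->.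
have H2G : subrel H2 (edge G).
  by move=> x y /or3P[/HG//|/pendG//|/pendG]; rewrite edge_sym.
have to_core x : exists2 y, 0 < dg H y & connect H2 x y.
  have [x0|x0] := posnP (dg H x); last by exists x; rewrite ?connect0.
  have /andP[_ p0] := parP x x0; exists (par x) => //; apply: connect1.
  by rewrite /H2 /pend x0 !eqxx orbT.
have H2conn x y : connect H2 x y.
  have [[x' x'0 xx'] [y' y'0 yy']] := (to_core x, to_core y).
  apply: connect_trans xx' _; rewrite (sym_connect_sym H2sym).
  apply: connect_trans yy' _; apply: connect_sub (Hconn _ _ y'0 x'0) => a b ab.
  by apply: connect1; rewrite /H2 ab.
have [T Tspan TH2] := exists_spanning_tree V0 H2G H2sym H2conn.
exists T; split=> //.
have outer x : dg H x = 0 -> deg T x <= 1.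
  move=> x0; apply: leq_trans (leq_dg x TH2) _.
  rewrite -(cards1 (par x)); apply/subset_leq_card/subsetP=> y; rewrite !inE.
  case/or3P=> [xy|/andP[]//|/andP[/eqP/parP/andP[_ +] /eqP xp]].
    by rewrite (dg0_edgeF y x0) in xy.
  by rewrite -xp x0.
have T0 x : 1 < deg T x -> 0 < dg H x.
  by move=> x2; rewrite lt0n; apply: contraTneq x2 => /outer; rewrite -leqNgt.
have coreH x y : 0 < dg H x -> 0 < dg H y -> H2 x y -> H x y.
  by move=> x0 y0 /or3P[]// /andP[/eqP E _]; [rewrite E in x0 | rewrite E in y0].
have stem_deg (u : {x | x \in ~: leaves T}) :
    3 <= deg (stem T) u -> deg (stem T) u <= dg H (val u).
  move=> u3; have uT : deg (stem T) u <= deg T (val u).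
    rewrite {1}/deg -(card_imset _ val_inj); apply/subset_leq_card/subsetP=> w.
    by case/imsetP=> v; rewrite !inE => uv ->.
  have u0 : 0 < dg H (val u) by apply: T0; apply: leq_trans uT; apply: ltnW.
  rewrite {1}/deg -(card_imset _ val_inj); apply/subset_leq_card/subsetP=> w.
  case/imsetP=> v; rewrite !inE => uv ->; apply: coreH (TH2 _ _ uv) => //.
  apply: T0; have := valP v; rewrite !inE.
  have : 0 < deg T (val v) by apply: (@dg_gt0 _ _ _ (val u)); rewrite edge_sym.
  by case: (deg T (val v)) => [|[]].
rewrite -(card_imset _ val_inj) -sum1_card big_mkcond; apply: leq_sum => x _.
case: ifP => // /imsetP[u]; rewrite inE => u3 ->.
by have := leq_trans u3 (stem_deg u u3); case: (dg H (val u)) => [|[|[]]].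
Qed.

Lemma dist_ge5 x y : ~ within4 G x y -> (5%:Z%:E <= dist G x y)%E.
Proof.
move=> far; apply: le_bigmin => [|n /existsP[p /andP[xp px]]].
  by rewrite leey.
rewrite lee_fin lez_nat leqNgt; apply/negP=> n5.
have : size p < 5 by rewrite size_tuple.
case: (val p) xp px => [|a [|s [|c [|d [|//]]]]] /= xp /eqP E _.
- by apply: far; exists x, x, x; split; left.
- apply: far; exists x, x, x.
  by split; [left | left | left | right; rewrite -E; case/andP: xp].
- case/and3P: xp => xa as_ _; apply: far; exists x, x, a.
  by split; [left | left | right | right; rewrite -E].
- case/and4P: xp => xa as_ sc _; apply: far; exists x, a, s.
  by split; [left | right | right | right; rewrite -E].
- case/and5P: xp => xa as_ sc cd _; apply: far; exists a, s, c.
  by split; right=> //; rewrite -E.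
Qed.

End Spanning.

Lemma sigma_le (V : finType) (G : sgraph V) x y : x != y ->
  (5%:Z%:E <= dist G x y)%E -> (5%:Z%:E <= dist G y x)%E ->
  (sigma 5 2 G <= (deg G x + deg G y)%N%:Z%:E)%E.
Proof.
move=> xy dxy dyx; pose S := [set x; y].
have cS : #|S| = 2 by rewrite cards2 xy.
have scS : scattered 5 G S.
  apply/forallP=> u; apply/implyP; rewrite !inE => uS.
  apply/forallP=> v; apply/implyP; rewrite !inE => vS; apply/implyP.
  by case/orP: uS => /eqP->; case/orP: vS => /eqP->; rewrite ?eqxx.
have -> : sigma 5 2 G = \big[Order.min/+oo%E]_(S : {set V} | (#|S| == 2) && scattered 5 G S)
    ((\sum_(a in S) deg G a)%N%:Z)%:E.
  rewrite /sigma ifF //; apply/negbTE; rewrite -leqNgt /alpha.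
  by apply: (bigop.bigmax_sup S scS); rewrite cS.
have <- : \sum_(a in S) deg G a = deg G x + deg G y.
  by rewrite big_setU1 ?inE // big_set1.
by apply: bigmin_le_cond; rewrite cS eqxx.
Qed.

Lemma exists_dominating_low_excess (V : finType) (G : sgraph V) (k : nat) :
  connected_graph G -> claw_free G -> 1 < #|V| ->
  ((#|V|%:Z - 3 * k%:Z - 6)%R%:E <= sigma 5 2 G)%E ->
  exists H, [/\ connected_sub G H, dominating G H & excess H <= k].
Proof.
move=> [_ Gconn] claw V1 sig.
have deg0 x : 0 < dg (edge G) x.
  have /card_gt0P[y yx] : 0 < #|[set~ x]|.
    by rewrite cardsC1 -subn1 subn_gt0.
  by apply: connect_neq_dg (Gconn x y) _; rewrite !inE eq_sym in yx.
have Gc : connected_sub G (edge G) by split=> //; apply: edge_sym.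
have Gd : dominating G (edge G) by move=> x x0; have := deg0 x; rewrite x0.
have [H [Hc Hd] Hmin] : exists2 H, connected_sub G H /\ dominating G H &
    forall H', connected_sub G H' /\ dominating G H' -> excess H <= excess H'.
  by apply: (ex_least (P := fun H => connected_sub G H /\ dominating G H)); exists (edge G).
exists H; split=> //; have [->//|Hp] := posnP (excess H).
have Hopt : optimal G H by split=> // H' H'c H'd; apply: Hmin.
have [K [l [p Kbest]]] := best_exists Hopt.
have [x [y [xy far cnt]]] := best_degree_sum claw Kbest.
have HK : excess H <= excess K by have [[[Kc Kd _ _] _ _] _ _] := Kbest; apply: Hmin.
have dxy : (5%:Z%:E <= dist G x y)%E by apply: dist_ge5.
have dyx : (5%:Z%:E <= dist G y x)%E.
  have wC u v : u = v \/ edge G u v -> v = u \/ edge G v u.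
    by case=> [->|]; [left | rewrite edge_sym; right].
  apply: dist_ge5 => -[a [s [c [/wC ya /wC as_ /wC sc /wC cx]]]].
  by apply: far; exists c, s, a.
have := le_trans sig (sigma_le xy dxy dyx); rewrite lee_fin.
by rewrite -[deg G x]/(dg (edge G) x) -[deg G y]/(dg (edge G) y); move: HK cnt; clear; lia.
Qed.

Theorem theorem1p9 (V : finType) (G : sgraph V) (k : nat)
    (G_conn : connected_graph G) (G_claw_free : claw_free G)
    (G_sigma : ((#|V|%:Z - 3 * k%:Z - 6)%R%:E <= sigma 5 2 G)%E) :
  exists T : sgraph V,
    spanning_tree G T /\ #|branch_vertices (stem T)| <= k.
Proof.
(* A dominating subgraph has an edge, so a single vertex is a case apart. *)
have [V0 _] := G_conn; have [V1|V1] := leqP #|V| 1.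
  exists G; split.
    split=> //; split=> // p p3 /andP[_ /card_uniqP p_uniq].
    have := max_card (mem p); rewrite p_uniq => /leq_trans/(_ V1).
    by case: p p3 {p_uniq} => [|? []].
  rewrite (_ : branch_vertices _ = set0) ?cards0 //; apply/setP=> u.
  rewrite !inE; apply/negbTE; rewrite -ltnNge.
  apply: leq_ltn_trans (max_card _) _; rewrite card_sig.
  exact: leq_ltn_trans (max_card _) (leq_ltn_trans V1 _).
have [H [Hc Hd Hk]] := exists_dominating_low_excess G_conn G_claw_free V1 G_sigma.
have [T [Tspan Tstem]] := stem_branches_le_excess V0 Hc Hd.
by exists T; split; rewrite // (leq_trans Tstem).
Qed.
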